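(* Let $n\in\mathbb{N}$, $m\in\{0,\ldots,n-1\}$, and let $\mu$ be a self-similar measure on a self-similar set $E\subset\mathbb{R}^n$ satisfying the open set condition. If $\mu$ is purely $m$-unrectifiable and $0<\alpha\le 1$, then $$\overline{\dim}_{\mathrm{loc}}(\mu,x)=\limsup_{r\downarrow 0}\ \sup_{\theta\in S^{n-1},\,V\in G(n,n-m)}\frac{\log\mu\bigl(B(x,r)\cap X(x,V,\alpha)\setminus H(x,\theta,\alpha)\bigr)}{\log r},$$ $$\underline{\dim}_{\mathrm{loc}}(\mu,x)=\liminf_{r\downarrow 0}\ \sup_{\theta\in S^{n-1},\,V\in G(n,n-m)}\frac{\log\mu\bigl(B(x,r)\cap X(x,V,\alpha)\setminus H(x,\theta,\alpha)\bigr)}{\log r}$$ for $\mu$-almost all $x\in\mathbb{R}^n$.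
   Context: Self-similar sets and measures: let $\kappa\ge 2$ and for each $i\in\{1,\ldots,\kappa\}$ let $f_i\colon\mathbb{R}^n\to\mathbb{R}^n$ and $0<r_i<1$ satisfy $|f_i(x)-f_i(y)|=r_i|x-y|$ for all $x,y\in\mathbb{R}^n$. The self-similar set $E$ is the unique nonempty compact set with $E=\bigcup_{i=1}^\kappa f_i(E)$. The open set condition is satisfied if there is a nonempty open set $U$ with $\bigcup_{i=1}^\kappa f_i(U)\subset U$, the union being pairwise disjoint. Let $\Sigma=\{1,\ldots,\kappa\}^{\mathbb{N}}$ and let $\pi\colon\Sigma\to E$ be the natural projection, $\{\pi(i_1i_2\cdots)\}=\bigcap_{k}f_{i_1}\circ\cdots\circ f_{i_k}(E)$. Given a probability vector $(p_1,\ldots,p_\kappa)$, the Bernoulli measure $\nu$ on $\Sigma$ is determined by giving each cylinder $[i_1\cdots i_k]$ (all sequences beginning with $i_1\cdots i_k$) the measure $p_{i_1}\cdots p_{i_k}$; the self-similar measure on $E$ is the image $\mu=\pi\nu$ of $\nu$ under $\pi$. Notation: $B(x,r)$ is the closed ball with centre $x$ and radius $r>0$, $S^{n-1}$ the unit sphere of $\mathbb{R}^n$, $G(n,n-m)$ the space of all $(n-m)$-dimensional linear subspaces of $\mathbb{R}^n$. For $0\le\alpha\le 1$, $X(x,V,\alpha)=\{y\in\mathbb{R}^n:\operatorname{dist}(y-x,V)<\alpha|y-x|\}$ and $H(x,\theta,\alpha)=\{y\in\mathbb{R}^n:(y-x)\cdot\theta>\alpha|y-x|\}$. The upper and lower local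 dimensions of $\mu$ at $x$ are $\overline{\dim}_{\mathrm{loc}}(\mu,x)=\limsup_{r\downarrow 0}\frac{\log\mu(B(x,r))}{\log r}$ and $\underline{\dim}_{\mathrm{loc}}(\mu,x)=\liminf_{r\downarrow 0}\frac{\log\mu(B(x,r))}{\log r}$. Convention: $\log 0=-\infty$, so $\log 0/\log r=+\infty$ for $0<r<1$. A set $A\subset\mathbb{R}^n$ is $m$-rectifiable if there are Lipschitz maps $g_i\colon\mathbb{R}^m\to\mathbb{R}^n$, $i\in\mathbb{N}$, such that $\mathcal{H}^m\bigl(A\setminus\bigcup_i g_i(\mathbb{R}^m)\bigr)=0$, where $\mathcal{H}^m$ is the $m$-dimensional Hausdorff measure. A measure $\mu$ is purely $m$-unrectifiable if $\mu(A)=0$ for all $m$-rectifiable sets $A\subset\mathbb{R}^n$. *)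

(* Defs.v *)
From HB Require Import structures.
From mathcomp Require Import all_boot all_order all_algebra.
From mathcomp Require Import all_classical all_reals all_analysis.

Set Implicit Arguments.
Unset Strict Implicit.
Unset Printing Implicit Defensive.

Import Order.TTheory GRing.Theory Num.Theory.
Import numFieldNormedType.Exports.

Local Open Scope classical_set_scope.
Local Open Scope ring_scope.

Section EuclideanSpace.
Context {R : realType} {n : nat}.
Implicit Types (x y theta : 'rV[R]_n) (V : {vspace 'rV[R]_n}) (A : set 'rV[R]_n).

Definition dotv x y : R := \sum_(i < n) x ord0 i * y ord0 i.

(* The library norm on ['rV[R]_n] is the sup norm, so the Euclidean one is
   defined here.  Both induce the same topology, hence [open], [compact] and
   the Borel sets below are the library ones. *)
Definition enorm x : R := Num.sqrt (dotv x x).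

Definition eball x (r : R) : set 'rV[R]_n := [set y | enorm (y - x) <= r].

Definition esphere : set 'rV[R]_n := [set theta | enorm theta = 1].

Definition edist_vspace x V : R := inf [set enorm (x - v) | v in [set v | v \in V]].

Definition grassmannian (d : nat) : set {vspace 'rV[R]_n} := [set V | \dim V = d].

Definition xcone x V (alpha : R) : set 'rV[R]_n :=
  [set y | edist_vspace (y - x) V < alpha * enorm (y - x)].

Definition hcone x theta (alpha : R) : set 'rV[R]_n :=
  [set y | dotv (y - x) theta > alpha * enorm (y - x)].

Definition ediam A : \bar R :=
  ereal_sup [set (enorm (x - y))%:E | x in A & y in A].

(* [diam(A)^m] with [diam(set0)^m = 0] and, for m = 0, [diam(A)^0 = 1] for
   every nonempty A, so that [hausdorff_measure 0] is the counting measure. *)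
Definition ediam_pow (m : nat) A : \bar R :=
  if A == set0 then 0%E else (ediam A ^+ m)%E.

Definition hausdorff_content (m : nat) (delta : R) A : \bar R :=
  ereal_inf [set (\sum_(k <oo) ediam_pow m (U k))%E | U in
    [set U : (set 'rV[R]_n)^nat |
       A `<=` \bigcup_k U k /\ forall k, (ediam (U k) <= delta%:E)%E]].

Definition hausdorff_measure (m : nat) A : \bar R :=
  ereal_sup [set hausdorff_content m delta A | delta in [set delta : R | 0 < delta]].

End EuclideanSpace.

Definition lipschitz_map {R : realType} {m n : nat} (g : 'rV[R]_m -> 'rV[R]_n) :=
  exists L : R, forall x y, enorm (g x - g y) <= L * enorm (x - y).

Definition borel_rV (R : realType) (n : nat) := g_sigma_algebraType (@open 'rV[R]_n).

Section Measures.
Context {R : realType} {n : nat}.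

Definition rectifiable (m : nat) (A : set 'rV[R]_n) :=
  exists g : nat -> 'rV[R]_m -> 'rV[R]_n,
    (forall i, lipschitz_map (g i)) /\
    hausdorff_measure m (A `\` \bigcup_i range (g i)) = 0%E.

(* A need not be a Borel set: [mu^*] is the outer measure extending mu. *)
Definition purely_unrectifiable (m : nat) (mu : {measure set borel_rV R n -> \bar R}) :=
  forall A : set (borel_rV R n), rectifiable m A -> (mu^*)%mu A = 0%E.

(* log (mu A) / log r; [lne 0 = -oo], so this is [+oo] if [mu A = 0] and
   0 < r < 1. *)
Definition log_ratio (mu : {measure set borel_rV R n -> \bar R})
  (A : set (borel_rV R n)) (r : R) : \bar R := (lne (mu A) / (ln r)%:E)%E.

Definition upper_local_dim mu (x : borel_rV R n) : \bar R :=
  limf_esup (fun r : R => log_ratio mu (eball x r) r) 0^'+.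

Definition lower_local_dim mu (x : borel_rV R n) : \bar R :=
  limf_einf (fun r : R => log_ratio mu (eball x r) r) 0^'+.

Definition sup_cone_log_ratio mu (m : nat) (alpha : R) (x : borel_rV R n) (r : R) : \bar R :=
  ereal_sup [set log_ratio mu
                   ((eball x r `&` xcone x V alpha) `\` hcone x theta alpha) r
            | theta in esphere & V in grassmannian (n - m)].

End Measures.

Definition cylinder (kappa : nat) (w : seq 'I_kappa) : set (nat -> 'I_kappa) :=
  [set s | mkseq s (size w) = w].

(* The library requires measurable types to be pointed, hence inhabited: this is
   why the code space records the assumption on the number of symbols. *)
Definition codespace (kappa : nat) (hkappa : (2 <= kappa)%N) := nat -> 'I_kappa.

HB.instance Definition _ (kappa : nat) (hkappa : (2 <= kappa)%N) :=
  Choice.on (codespace hkappa).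
HB.instance Definition _ (kappa : nat) (hkappa : (2 <= kappa)%N) :=
  isPointed.Build (codespace hkappa) (fun=> Ordinal (ltnW hkappa)).

Definition borel_codespace (kappa : nat) (hkappa : (2 <= kappa)%N) :=
  g_sigma_algebraType (range (@cylinder kappa) : set (set (codespace hkappa))).

Section SelfSimilar.
Context {R : realType} {n : nat}.

Definition contracting_similarities (kappa : nat)
    (f : 'I_kappa -> 'rV[R]_n -> 'rV[R]_n) (r : 'I_kappa -> R) :=
  forall i, 0 < r i < 1 /\ forall x y, enorm (f i x - f i y) = r i * enorm (x - y).

Definition self_similar_set (kappa : nat)
    (f : 'I_kappa -> 'rV[R]_n -> 'rV[R]_n) (E : set 'rV[R]_n) :=
  [/\ E !=set0, compact E & E = \bigcup_i f i @` E].

Definition open_set_condition (kappa : nat) (f : 'I_kappa -> 'rV[R]_n -> 'rV[R]_n) :=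
  exists U : set 'rV[R]_n,
    [/\ U !=set0, open U, \bigcup_i f i @` U `<=` U
      & trivIset setT (fun i => f i @` U)].

Definition probability_vector (kappa : nat) (p : 'I_kappa -> R) :=
  (forall i, 0 <= p i) /\ \sum_i p i = 1.

Definition is_bernoulli (kappa : nat) (hkappa : (2 <= kappa)%N) (p : 'I_kappa -> R)
    (nu : {measure set borel_codespace hkappa -> \bar R}) :=
  forall w : seq 'I_kappa, nu (cylinder w) = (\prod_(i <- w) p i)%:E.

(* [comp_word f [:: i1; ...; ik] = f i1 \o ... \o f ik] *)
Definition comp_word (kappa : nat) (f : 'I_kappa -> 'rV[R]_n -> 'rV[R]_n)
    (w : seq 'I_kappa) : 'rV[R]_n -> 'rV[R]_n :=
  foldr (fun i g => f i \o g) id w.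

Definition natural_projection (kappa : nat)
    (f : 'I_kappa -> 'rV[R]_n -> 'rV[R]_n) (E : set 'rV[R]_n)
    (pi : (nat -> 'I_kappa) -> 'rV[R]_n) :=
  forall s, [set pi s] = \bigcap_k (comp_word f (mkseq s k) @` E).

Definition self_similar_measure (kappa : nat) (hkappa : (2 <= kappa)%N)
    (f : 'I_kappa -> 'rV[R]_n -> 'rV[R]_n) (E : set 'rV[R]_n) (p : 'I_kappa -> R)
    (mu : {measure set borel_rV R n -> \bar R}) :=
  exists (nu : {measure set borel_codespace hkappa -> \bar R})
         (pi : borel_codespace hkappa -> borel_rV R n),
    [/\ is_bernoulli p nu, natural_projection f E pi
      & forall A, measurable A -> mu A = pushforward nu pi A].

End SelfSimilar.

(* Main.v *)
Require Import Defs.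
From mathcomp Require Import all_boot all_order all_algebra.
From mathcomp Require Import all_classical all_reals all_analysis.
From mathcomp Require Import measurable_realfun ring lra zify.

Set Implicit Arguments.
Unset Strict Implicit.
Unset Printing Implicit Defensive.

Import Order.TTheory GRing.Theory Num.Theory.
Import numFieldNormedType.Exports.

Local Open Scope classical_set_scope.
Local Open Scope ring_scope.

(** A cone at [x] is contained in the ball of the same radius and [ln r < 0], so the
    ratio of a cone dominates the ratio of the ball.  The converse holds up to an
    arbitrarily small error because almost surely no cone is much lighter than the
    ball: for every [delta > 0], once [r] is small, every cone of radius [r] at [x]
    has mass at least [c * r `^ delta] times the mass of the ball ([cone_mass_ae]).
    After taking logarithms the two ratios differ by at most [delta + o(1)],
    uniformly in the plane and the direction, so they have the same limits superior
    and inferior ([limf_eq_of_close]).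

    For a finite word [w] let [p_w] and [r_w] be the products of the probabilities
    and of the ratios along [w], and let [E_w] be the image of [E] under the
    composition of the maps along [w].  The estimate rests on three facts about a
    random address.

    The balls are not much heavier than the words.  Enclose the neighbourhood of
    [E_w] of radius [r_w] in a ball of comparable radius.  By the open set condition
    these balls, for the words [w] of length [k], cover no point more than [O(k)]
    times ([word_ball_multiplicity]).  By
    Markov's inequality the words whose ball has more than [t ^ (2 k)] times the
    mass [p_w] have total probability [O(t ^ -k)] ([sum_heavy_ball_words]).

    There is a word [w0] such that every cone at every point of [E_w0] contains one
    of finitely many pieces [E_u] ([nonflat_word]).  It suffices to deal with a
    finite net of slightly smaller cones, and with one charged point that has
    charged points in all of them.  If there were no such point, the charged points
    would be covered by finitely many sets [F], one for each cone of the net, such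
    that no point of [F] sees another one in the cone.  Such a set is a Lipschitz
    graph: if [y - x] is close to the plane, then one of [y - x] and [x - y] is in
    the remaining half of the cone ([not_narrow_graph]).  This contradicts pure
    unrectifiability.

    The word [w0] keeps occurring with short delays: the probability that it does
    not occur within a delay of [k * size w0 / Q] after the position [k] decreases
    exponentially in [k] ([sum_late_gap]).

    By the Borel-Cantelli lemma almost every point has addresses along which all
    this holds from some length on ([ae_regular_addresses]).  Given [r], let [v] be
    the prefix with [r_v] comparable to [r] and let [v'] be the prefix that precedes
    the next occurrence of [w0].  The similarity of [v'] carries one of the pieces
    [E_u] into the given cone, so the cone has mass at least [p_v' * p_u].  Since
    [v'] is hardly longer than [v], this is at least a small power of [r] times
    [p_v], which in turn is at least a small power of [r] times the mass of the
    ball.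

    Planes enter only through systems of unit normals ([vspace_normals]), so that
    nets of the unit ball of [R^n] take the place of the compactness of the
    Grassmannian. *)

(** * The Euclidean norm *)

Section Euclidean.
Context {R : realType} {n : nat}.
Implicit Types x y z : 'rV[R]_n.

Lemma dotvE x y : dotv x y = (x *m y^T) ord0 ord0.
Proof. by rewrite mxE; apply: eq_bigr => i _; rewrite mxE. Qed.

Lemma dotvC x y : dotv x y = dotv y x.
Proof. by apply: eq_bigr => i _; rewrite mulrC. Qed.

Lemma dotvDl x y z : dotv (x + y) z = dotv x z + dotv y z.
Proof. by rewrite !dotvE mulmxDl mxE. Qed.

Lemma dotvZl a x y : dotv (a *: x) y = a * dotv x y.
Proof. by rewrite !dotvE -scalemxAl mxE. Qed.

Lemma dotvNl x y : dotv (- x) y = - dotv x y.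
Proof. by rewrite -scaleN1r dotvZl mulN1r. Qed.

Lemma dotvBl x y z : dotv (x - y) z = dotv x z - dotv y z.
Proof. by rewrite dotvDl dotvNl. Qed.

Lemma dotvDr x y z : dotv x (y + z) = dotv x y + dotv x z.
Proof. by rewrite dotvC dotvDl !(dotvC x). Qed.

Lemma dotvZr a x y : dotv x (a *: y) = a * dotv x y.
Proof. by rewrite dotvC dotvZl dotvC. Qed.

Lemma dotvBr x y z : dotv x (y - z) = dotv x y - dotv x z.
Proof. by rewrite dotvC dotvBl !(dotvC x). Qed.

Lemma dotv_mulmx (O : 'M[R]_n) x y : dotv (x *m O) y = dotv x (y *m O^T).
Proof. by rewrite !dotvE trmx_mul trmxK mulmxA. Qed.

Lemma dotv_ge0 x : 0 <= dotv x x.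
Proof. by apply: sumr_ge0 => i _; rewrite -expr2 sqr_ge0. Qed.

Lemma dotv_eq0 x : dotv x x = 0 -> x = 0.
Proof.
move/eqP; rewrite psumr_eq0 => [/allP h|i _]; last by rewrite -expr2 sqr_ge0.
apply/rowP => i; rewrite mxE; apply/eqP.
by have := h i (mem_index_enum _); rewrite /= mulf_eq0 orbb.
Qed.

Lemma enorm_ge0 x : 0 <= enorm x. Proof. exact: sqrtr_ge0. Qed.
Hint Resolve enorm_ge0 : core.

Lemma sqr_enorm x : enorm x ^+ 2 = dotv x x.
Proof. by rewrite sqr_sqrtr ?dotv_ge0. Qed.

Lemma enorm_eq0 x : enorm x = 0 -> x = 0.
Proof. by move=> x0; apply: dotv_eq0; rewrite -sqr_enorm x0 expr0n. Qed.

Lemma enorm0 : enorm (0 : 'rV[R]_n) = 0.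
Proof. by rewrite /enorm -(scale0r 0) dotvZl mul0r sqrtr0. Qed.

Lemma enorm_gt0 x : x != 0 -> 0 < enorm x.
Proof.
by move=> x0; rewrite lt0r enorm_ge0 andbT; apply: contra_neq x0; exact: enorm_eq0.
Qed.

Lemma enormZ a x : enorm (a *: x) = `|a| * enorm x.
Proof.
by rewrite /enorm dotvZl dotvZr mulrA -expr2 sqrtrM ?sqr_ge0// sqrtr_sqr.
Qed.

Lemma enormN x : enorm (- x) = enorm x.
Proof. by rewrite -scaleN1r enormZ normrN1 mul1r. Qed.

Lemma enormC x y : enorm (x - y) = enorm (y - x).
Proof. by rewrite -enormN opprB. Qed.

Lemma dotv_le x y : dotv x y <= enorm x * enorm y.
Proof.
have [->|x0] := eqVneq x 0.
  by rewrite -(scale0r 0) dotvZl mul0r mulr_ge0.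
have nx := enorm_gt0 x0.
have := dotv_ge0 (enorm y *: x - enorm x *: y).
rewrite dotvBl !dotvBr !dotvZl !dotvZr (dotvC y x) -!sqr_enorm.
have [->|y0] := eqVneq y 0.
  by move=> _; rewrite dotvC -(scale0r 0) dotvZl mul0r mulr_ge0.
have ny := enorm_gt0 y0; set a := enorm x in nx *; set b := enorm y in ny *.
move=> h; have ab : 0 < a * b by rewrite mulr_gt0.
rewrite -(ler_pM2l ab); nra.
Qed.

Lemma norm_dotv_le x y : `|dotv x y| <= enorm x * enorm y.
Proof.
rewrite ler_norml dotv_le andbT lerNl -dotvNl -(enormN x); exact: dotv_le.
Qed.

Lemma enormD x y : enorm (x + y) <= enorm x + enorm y.
Proof.
rewrite -(@ler_pXn2r _ 2) ?nnegrE ?addr_ge0// sqrrD !sqr_enorm.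
rewrite dotvDl !dotvDr (dotvC y x) -!sqr_enorm; have := dotv_le x y; lra.
Qed.

Lemma enorm_triangle y x z : enorm (x - z) <= enorm (x - y) + enorm (y - z).
Proof. by apply: le_trans (enormD _ _); rewrite addrA subrK. Qed.

Lemma dist_enorm x y : `|enorm x - enorm y| <= enorm (x - y).
Proof.
rewrite ler_norml; have := enorm_triangle y x 0; have := enorm_triangle x y 0.
rewrite !subr0 (enormC y x); lra.
Qed.

Lemma enorm_sum_le (I : finType) (F : I -> 'rV[R]_n) :
  enorm (\sum_i F i) <= \sum_i enorm (F i).
Proof.
elim/big_ind2: _ => [|x a y b xa yb|//]; first by rewrite enorm0.
by apply: le_trans (enormD _ _) _; exact: lerD.
Qed.

Lemma norm_coord_le x i : `|x ord0 i| <= enorm x.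
Proof.
rewrite -(@ler_pXn2r _ 2) ?nnegrE// sqr_enorm real_normK ?num_real//.
rewrite /dotv (bigD1 i)//= -expr2 lerDl.
by apply: sumr_ge0 => j _; rewrite -expr2 sqr_ge0.
Qed.

Lemma enorm_le_sum x : enorm x <= \sum_(i < n) `|x ord0 i|.
Proof.
have s0 : 0 <= \sum_(i < n) `|x ord0 i| by apply: sumr_ge0.
rewrite -(@ler_pXn2r _ 2) ?nnegrE// sqr_enorm expr2 mulr_suml.
apply: ler_sum => i _; rewrite (le_trans (ler_norm _))// normrM.
by rewrite ler_wpM2l// (bigD1 i)//= lerDl sumr_ge0.
Qed.

Lemma enorm_le_norm x : enorm x <= n%:R * `|x|.
Proof.
apply: le_trans (enorm_le_sum x) _.
rewrite mulr_natl -[X in _ *+ X]card_ord -sumr_const; apply: ler_sum => i _.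
by rewrite [leRHS]/Num.Def.normr/= mx_normrE (le_bigmax _ _ (ord0, i)).
Qed.

Lemma norm_le_enorm x : `|x| <= enorm x.
Proof.
rewrite [leLHS]/Num.Def.normr/= mx_normrE; apply: bigmax_le => // -[i j] _ /=.
by rewrite ord1 norm_coord_le.
Qed.

(** The topology is the one of the sup norm, which is equivalent to the Euclidean
    norm. *)
Lemma continuous_of_lipschitz {V : normedModType R} (g : 'rV[R]_n -> V) (L : R) :
  (forall x y, `|g x - g y| <= L * enorm (x - y)) -> continuous g.
Proof.
move=> gL x; apply/(@cvgrPdist_lt _ _ _ _ (nbhs_filter x)) => e e0.
have L0 : 0 < `|L| * n%:R + 1 by rewrite ltr_wpDl// mulr_ge0.
have : \forall y \near x, `|x - y| < e / (`|L| * n%:R + 1).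
  have := @nbhsx_ballx R _ x _ (divr_gt0 e0 L0).
  by rewrite -ball_normE.
apply: (@filterS _ _ (nbhs_filter x)) => y; rewrite ltr_pdivlMr// mulrC.
apply: le_lt_trans.
rewrite (le_trans (gL _ _))// mulrDl mul1r -mulrA.
apply: (@le_trans _ _ (`|L| * (n%:R * `|x - y|))); last by rewrite lerDl.
apply: (@le_trans _ _ (`|L| * enorm (x - y))).
  by rewrite ler_wpM2r ?ler_norm.
by rewrite ler_wpM2l ?enorm_le_norm.
Qed.

Lemma enorm_continuous : continuous (@enorm R n).
Proof.
apply: (@continuous_of_lipschitz _ _ 1) => x y; rewrite mul1r ler_norml.
have := enorm_triangle y x 0; have := enorm_triangle x y 0.
rewrite !subr0 (enormC y x); lra.
Qed.

Lemma sub_continuous x : continuous (fun y : 'rV[R]_n => y - x).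
Proof.
apply: (@continuous_of_lipschitz _ _ 1) => y z.
by rewrite mul1r opprB addrA subrK norm_le_enorm.
Qed.

Lemma closed_eball x r : closed (eball x r).
Proof.
have -> : eball x r = (fun y => enorm (y - x)) @^-1` [set s | s <= r] by [].
apply: (@preimage_closed _ _ _ [set s | s <= r]); last exact: (@closed_le R r).
move=> y _; apply: continuous_comp; [exact: sub_continuous|exact: enorm_continuous].
Qed.

Lemma open_nbhs_eball (U : set 'rV[R]_n) x : open U -> U x ->
  exists2 c, 0 < c & eball x c `<=` U.
Proof.
move=> oU Ux; have /nbhs_ballP[c /= c0 cU] : nbhs x U by exact: open_nbhs_nbhs.
exists (c / 2); first by rewrite divr_gt0.
move=> y; rewrite /eball/= enormC => xy; apply: cU; rewrite -ball_normE /=.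
rewrite (le_lt_trans (norm_le_enorm _))// (le_lt_trans xy)// gtr_pMr//.
by rewrite invf_lt1// ltr1n.
Qed.

End Euclidean.
#[global] Hint Extern 0 (is_true (0 <= enorm _)) => solve [apply: enorm_ge0] : core.

Lemma lipschitz_continuous {R : realType} {n p : nat} (g : 'rV[R]_n -> 'rV[R]_p) (L : R) :
  (forall x y, enorm (g x - g y) <= L * enorm (x - y)) -> continuous g.
Proof.
move=> gL; apply: (@continuous_of_lipschitz _ _ _ _ L) => x y.
exact: le_trans (norm_le_enorm _) (gL _ _).
Qed.

(** * Similarities and normals *)

Lemma dotv_delta {R : realType} {n : nat} (x : 'rV[R]_n) i :
  dotv x (delta_mx ord0 i) = x ord0 i.
Proof.
rewrite /dotv (bigD1 i)//= mxE !eqxx mulr1 big1 ?addr0// => j ji.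
by rewrite mxE (negbTE ji) andbF mulr0.
Qed.

(** Distances determine inner products by polarisation, and a map of [R^n] that
    preserves inner products is given by the matrix of the images of the standard
    basis. *)
Lemma similarity_affine {R : realType} {n : nat} (f : 'rV[R]_n -> 'rV[R]_n) (r : R) :
  0 < r -> (forall x y, enorm (f x - f y) = r * enorm (x - y)) ->
  exists2 O : 'M[R]_n, O *m O^T = 1%:M &
    forall x y, f x - f y = r *: ((x - y) *m O).
Proof.
move=> r0 fr; pose g x := r^-1 *: (f x - f 0).
have gB x y : g x - g y = r^-1 *: (f x - f y).
  by rewrite /g -scalerBr opprB addrA subrK.
have gn x y : dotv (g x - g y) (g x - g y) = dotv (x - y) (x - y).
  rewrite -!sqr_enorm gB enormZ fr gtr0_norm ?invr_gt0// mulrA mulVf ?mul1r//.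
  by rewrite gt_eqF.
have g0 : g 0 = 0 by rewrite /g subrr scaler0.
have gn0 x : dotv (g x) (g x) = dotv x x.
  by have := gn x 0; rewrite g0 !subr0.
have gd x y : dotv (g x) (g y) = dotv x y.
  have := gn x y; rewrite !dotvBl !dotvBr !gn0 (dotvC (g y)) (dotvC y); lra.
pose O : 'M[R]_n := \matrix_(i, j) g (delta_mx ord0 i) ord0 j.
have gO x : g x *m O^T = x.
  apply/rowP => i; rewrite mxE -[RHS]dotv_delta -gd.
  by apply: eq_bigr => j _; rewrite !mxE.
have OO : O *m O^T = 1%:M.
  apply/row_matrixP => i; rewrite row_mul row1.
  rewrite -[RHS]gO; congr (_ *m _); apply/rowP => j; by rewrite !mxE.
exists O => // x y.
have -> : (x - y) *m O = g x - g y.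
  rewrite -{1}(gO x) -{1}(gO y) -mulmxBl -mulmxA.
  by rewrite (mulmx1C OO) mulmx1.
by rewrite gB scalerA mulfV ?gt_eqF// scale1r.
Qed.

Section Normals.
Context {R : realType} {n : nat}.
Implicit Types (x y : 'rV[R]_n) (V : {vspace 'rV[R]_n}).

Lemma edist_vspace_le x V v : v \in V -> edist_vspace x V <= enorm (x - v).
Proof.
move=> vV; apply: ge_inf; last by exists v.
by exists 0 => _ [w _ <-].
Qed.

Lemma edist_vspace_lipschitz V x y :
  edist_vspace x V <= edist_vspace y V + enorm (x - y).
Proof.
rewrite -lerBlDr; apply: lb_le_inf.
  by exists (enorm (y - 0)); exists 0 => //=; rewrite mem0v.
move=> _ [v vV <-]; rewrite lerBlDr addrC.
exact: le_trans (edist_vspace_le _ vV) (enorm_triangle y _ _).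
Qed.

Lemma unit_normal V : (\dim V < n)%N ->
  exists2 e : 'rV[R]_n, enorm e = 1 & forall v, v \in V -> dotv v e = 0.
Proof.
move=> dV; pose B : 'M[R]_(\dim V, n) := \matrix_(i, j) (vbasis V)`_i ord0 j.
have : kermx B^T != 0.
  rewrite -mxrank_eq0 mxrank_ker subn_eq0 -ltnNge.
  exact: leq_ltn_trans (rank_leq_col _) _.
case/rowV0Pn => u /sub_kermxP uB u0.
have un0 := enorm_gt0 u0.
exists ((enorm u)^-1 *: u).
  by rewrite enormZ gtr0_norm ?invr_gt0// mulVf ?gt_eqF.
move=> v vV; rewrite dotvZr (coord_vbasis vV).
suff -> : dotv (\sum_(i < \dim V) coord (vbasis V) i v *: (vbasis V)`_i) u = 0.
  by rewrite mulr0.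
rewrite dotvE mulmx_suml summxE big1// => i _.
rewrite -dotvE dotvZl dotvC.
suff -> : dotv u (vbasis V)`_i = 0 by rewrite mulr0.
have /rowP/(_ i) := uB; rewrite mxE [RHS]mxE => <-.
by apply: eq_bigr => j _; rewrite !mxE.
Qed.

(** Unit normals of [V], obtained by enlarging [V] one dimension at a
    time.  They replace the Grassmannian by a bounded set of tuples of vectors. *)
Lemma vspace_normals (m : nat) V : (\dim V + m = n)%N ->
  exists a : 'I_m -> 'rV[R]_n,
  [/\ forall i, enorm (a i) = 1, forall i v, v \in V -> dotv v (a i) = 0 &
      forall y, y - \sum_i dotv y (a i) *: a i \in V].
Proof.
elim: m V => [|m IH] V.
  rewrite addn0 => dV; exists (fun=> 0); split; [by case|by case|].
  move=> y; rewrite big_ord0 subr0.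
  have -> : V = fullv; last by rewrite memvf.
  by apply/eqP; rewrite eqEdim subvf/= dimvf /= dV /dim /= mul1n.
move=> dV.
have [|e e1 Ve] := @unit_normal V.
  by apply: leq_trans (eq_leq dV); rewrite addnS ltnS leq_addr.
have e0 : e != 0 by apply: contra_eq_neq e1 => ->; rewrite enorm0 eq_sym oner_eq0.
have ee : dotv e e = 1 by rewrite -sqr_enorm e1 expr1n.
have dVe : (\dim (V + <[e]>) = (\dim V).+1)%N.
  rewrite dimv_disjoint_sum ?dim_vline ?e0 ?addn1//.
  apply/eqP; rewrite -subv0; apply/subvP => v; rewrite memv_cap memv0.
  case/andP => vV /vlineP[k vk]; have := Ve _ vV.
  by rewrite vk dotvZl ee mulr1 => ->; rewrite scale0r.
have [|a [a1 aV aE]] := IH (V + <[e]>)%VS; first by rewrite dVe addSnnS.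
have VVe v : v \in V -> v \in (V + <[e]>)%VS by apply/subvP; exact: addvSl.
have eVe : e \in (V + <[e]>)%VS by apply: (subvP (addvSr _ _)); exact: memv_line.
exists (fun i => if unlift ord0 i is Some j then a j else e); split.
- by move=> i; case: unliftP.
- by move=> i v vV; case: unliftP => [j _|_]; [exact: aV (VVe _ vV)|exact: Ve].
move=> y; rewrite big_ord_recl unlift_none.
under eq_bigr do rewrite liftK.
have /memv_addP[v vV [_ /vlineP[t ->] yE]] := aE y.
suff -> : dotv y e = t.
  by rewrite opprD addrCA yE addrC addrK.
have <- : dotv (y - \sum_i dotv y (a i) *: a i) e = t.
  by rewrite yE dotvDl Ve// add0r dotvZl ee mulr1.
rewrite dotvBl; suff -> : dotv (\sum_i dotv y (a i) *: a i) e = 0.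
  by rewrite subr0.
rewrite dotvE mulmx_suml summxE big1// => i _.
by rewrite -dotvE dotvZl (dotvC (a i)) (aV _ _ eVe) mulr0.
Qed.

End Normals.

(** * Lipschitz graphs and narrow cones *)

(** McShane's extension: each point [x] of [F] imposes the upper bound
    [u x + L * enorm (z - P x)] on an extension, and the infimum of these bounds is
    [L]-Lipschitz and, by the hypothesis, attained at [x] when [z = P x]. *)
Lemma mcshane {R : realType} {m : nat} (T : Type) (F : set T) (P : T -> 'rV[R]_m)
    (u : T -> R) (L : R) :
  F !=set0 -> 0 <= L ->
  (forall x y, F x -> F y -> u x - u y <= L * enorm (P x - P y)) ->
  exists h : 'rV[R]_m -> R,
    (forall z z', h z - h z' <= L * enorm (z - z')) /\
    forall x, F x -> h (P x) = u x.
Proof.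
move=> [x0 Fx0] L0 uL.
pose S z := [set u x + L * enorm (z - P x) | x in F].
have lbS z : has_lbound (S z).
  exists (u x0 - L * enorm (P x0 - z)) => _ [x Fx <-].
  have := uL _ _ Fx0 Fx; have := ler_wpM2l L0 (enorm_triangle z (P x0) (P x)).
  rewrite mulrDr; lra.
have Sne z : S z !=set0 by exists (u x0 + L * enorm (z - P x0)); exists x0.
exists (fun z => inf (S z)); split.
  move=> z z'; rewrite lerBlDr addrC -lerBlDr; apply: lb_le_inf => // _ [x Fx <-].
  have : inf (S z) <= u x + L * enorm (z - P x).
    by apply: ge_inf => //; exists x.
  have := ler_wpM2l L0 (enorm_triangle z' z (P x)); rewrite mulrDr; lra.
move=> x Fx; apply/eqP; rewrite eq_le; apply/andP; split.
  by apply: ge_inf => //; exists x => //; rewrite subrr enorm0 mulr0 addr0.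
apply: lb_le_inf => // _ [y Fy <-].
by have := uL _ _ Fx Fy; lra.
Qed.

(** The map [x |-> (dotv x (a i))_i] has a Lipschitz inverse on its image of [F],
    and the coordinates of the inverse extend to [R^m]. *)
Lemma lipschitz_graph_cover {R : realType} {m n : nat} (F : set 'rV[R]_n)
    (a : 'I_m -> 'rV[R]_n) (c : R) : 0 < c ->
  (forall x y, F x -> F y -> c * enorm (x - y) <= \sum_i `|dotv (x - y) (a i)|) ->
  exists2 g : 'rV[R]_m -> 'rV[R]_n, lipschitz_map g & F `<=` range g.
Proof.
move=> c0 Fa.
have [->|F0] := eqVneq F set0.
  exists (fun=> 0) => //; exists 0 => x y.
  by rewrite subrr enorm0 mul0r.
pose P x : 'rV[R]_m := \row_i dotv x (a i).
pose L := c^-1 * m%:R.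
have L0 : 0 <= L by rewrite mulr_ge0// invr_ge0 ltW.
have FL x y : F x -> F y -> enorm (x - y) <= L * enorm (P x - P y).
  move=> Fx Fy; rewrite /L -mulrA ler_pdivlMl//.
  apply: le_trans (Fa _ _ Fx Fy) _.
  rewrite mulr_natl -[X in _ *+ X]card_ord -sumr_const; apply: ler_sum => i _.
  by apply: le_trans (norm_coord_le _ i); rewrite !mxE dotvBl.
have /choice[h hP] : forall i : 'I_n, exists h : 'rV[R]_m -> R,
    (forall z z', h z - h z' <= L * enorm (z - z')) /\
    forall x, F x -> h (P x) = x ord0 i.
  move=> i; apply: mcshane => //; first exact/set0P.
  move=> x y Fx Fy; apply: le_trans (FL _ _ Fx Fy).
  apply: le_trans (norm_coord_le _ i).
  by rewrite !mxE ler_norm.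
exists (fun z => \row_i h i z).
  exists (n%:R * L) => z z'; apply: le_trans (enorm_le_sum _) _.
  rewrite -mulrA mulr_natl -[X in _ *+ X]card_ord -sumr_const; apply: ler_sum => i _.
  rewrite !mxE ler_norml lerNl opprB (hP i).1 andbT enormC; exact: (hP i).1.
move=> x Fx; exists (P x) => //; apply/rowP => i; rewrite mxE.
exact: (hP i).2.
Qed.

Lemma hausdorff_measure_set0 {R : realType} {n : nat} (m : nat) :
  hausdorff_measure m (set0 : set 'rV[R]_n) = 0%E.
Proof.
have ediam_ge0 (B : set 'rV[R]_n) : B !=set0 -> (0 <= ediam B)%E.
  move=> [x Bx]; apply: ereal_sup_ubound; exists x => //; exists x => //.
  by rewrite subrr enorm0.
have pow_ge0 (B : set 'rV[R]_n) : (0 <= ediam_pow m B)%E.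
  rewrite /ediam_pow; case: ifPn => // /set0P B0.
  by rewrite expe_ge0// ediam_ge0.
have content0 d : hausdorff_content m d (set0 : set 'rV[R]_n) = 0%E.
  apply/eqP; rewrite eq_le; apply/andP; split.
    apply: ereal_inf_lbound; exists (fun=> set0).
      split=> // k; apply: ge_ereal_sup => _ [x []].
    by apply: eseries0 => k _ _; rewrite /ediam_pow eqxx.
  apply: le_ereal_inf_tmp => _ [U _ <-]; apply: nneseries_ge0 => k _ _.
  exact: pow_ge0.
apply/eqP; rewrite eq_le; apply/andP; split.
  by apply: ge_ereal_sup => _ [d _ <-]; rewrite content0.
by apply: ereal_sup_ubound; exists 1 => //=.
Qed.

Lemma rectifiable_finite_cover {R : realType} {m n : nat} (J : finType)
    (g : J -> 'rV[R]_m -> 'rV[R]_n) (A : set 'rV[R]_n) :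
  (forall j, lipschitz_map (g j)) ->
  (forall x, A x -> exists j, range (g j) x) -> rectifiable m A.
Proof.
move=> gL gA.
exists (fun k => if unpickle k is Some j then g j else fun=> 0); split.
  move=> k; case: (unpickle k) => [j|]; first exact: gL.
  by exists 0 => x y; rewrite /= subrr enorm0 mul0r.
set B := (X in A `\` X); have -> : A `\` B = set0.
  rewrite setD_eq0 => x /gA[j jx]; exists (pickle j) => //=.
  by rewrite pickleK.
exact: hausdorff_measure_set0.
Qed.

(** The plane is described by normals: this turns nets of planes into nets of vectors
    and lets similarities act on planes through their linear parts. *)
Definition narrow {R : realType} {m n : nat} (g : R) (a : 'I_m -> 'rV[R]_n)
    (theta z : 'rV[R]_n) :=
  [/\ z != 0, forall i, `|dotv z (a i)| <= g * enorm z & dotv z theta <= g * enorm z].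

Section Narrow.
Context {R : realType} {m n : nat}.
Implicit Types (a : 'I_m -> 'rV[R]_n) (theta z x y : 'rV[R]_n).

(** Each inner product changes by at most [2 * g * enorm z], and [enorm z] is at most
    [2 * enorm z']. *)
Lemma narrow_perturb g a a' theta theta' z z' : 0 < g <= 2^-1 ->
  (forall i, enorm (a' i) <= 1) -> enorm theta' <= 1 ->
  (forall i, enorm (a' i - a i) <= g) -> enorm (theta' - theta) <= g ->
  enorm (z' - z) <= g * enorm z ->
  narrow g a theta z -> narrow (6 * g) a' theta' z'.
Proof.
move=> /andP[g0 g2] a1 t1 aa tt zz [z0 za zt].
have nz := enorm_gt0 z0.
have zz' : enorm z <= 2 * enorm z'.
  have := enorm_triangle z' z 0; rewrite !subr0 (enormC z z').
  have := ler_wpM2r (ltW nz) g2; lra.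
have close v v' : enorm v' <= 1 -> enorm (v' - v) <= g ->
    `|dotv z' v' - dotv z v| <= 2 * g * enorm z.
  move=> v1 vv.
  have -> : dotv z' v' - dotv z v = dotv z (v' - v) + dotv (z' - z) v'.
    by rewrite dotvBr dotvBl; ring.
  apply: le_trans (ler_normD _ _) _.
  have h1 : `|dotv z (v' - v)| <= g * enorm z.
    by apply: le_trans (norm_dotv_le _ _) _; rewrite mulrC ler_wpM2r.
  have h2 : `|dotv (z' - z) v'| <= g * enorm z.
    apply: le_trans (norm_dotv_le _ _) _.
    by rewrite -[leRHS]mulr1; apply: ler_pM.
  lra.
have gz : g * enorm z <= 2 * g * enorm z'.
  by have := ler_wpM2l (ltW g0) zz'; lra.
split.
- by apply: contraTneq nz => z'0; rewrite -leNgt (le_trans zz')// z'0 enorm0 mulr0.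
- move=> i; have := close _ _ (a1 i) (aa i); have := za i.
  have := ler_normD (dotv z' (a' i) - dotv z (a i)) (dotv z (a i)); rewrite subrK; lra.
- have := close _ _ t1 tt; rewrite ler_norml => /andP[_]; lra.
Qed.

(** Round the coordinates down to multiples of [d]. *)
Lemma unit_ball_net (e : R) : 0 < e -> exists (T : finType) (vec : T -> 'rV[R]_n),
  forall x, enorm x <= 1 -> exists t, enorm (x - vec t) <= e.
Proof.
move=> e0; pose d := e / n.+1%:R.
have d0 : 0 < d by rewrite divr_gt0.
pose M := Num.truncn (2 / d).
exists {ffun 'I_n -> 'I_M.+1}.
exists (fun t : {ffun 'I_n -> 'I_M.+1} => \row_i ((t i)%:R * d - 1)) => x x1.
have xi i : -1 <= x ord0 i <= 1.
  by rewrite -ler_norml (le_trans (norm_coord_le _ _)).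
exists [ffun i => inord (Num.truncn ((x ord0 i + 1) / d))].
apply: le_trans (enorm_le_sum _) _.
apply: (@le_trans _ _ (\sum_(i < n) d)).
  apply: ler_sum => i _; rewrite !mxE ffunE inordK; last first.
    rewrite ltnS; apply: le_truncn; rewrite ler_pM2r ?invr_gt0//.
    by have /andP[] := xi i; lra.
  have x0 : 0 <= (x ord0 i + 1) / d.
    by rewrite divr_ge0 ?(ltW d0)//; have /andP[] := xi i; lra.
  have := truncn_itv x0; rewrite ler_pdivlMr// ltr_pdivrMr//.
  move=> /andP[]; rewrite -natr1 ler_norml.
  set q := (Num.truncn _)%:R; rewrite [(q + 1) * d]mulrDl; lra.
rewrite sumr_const card_ord -mulr_natl /d mulrCA ger_pMr//.
by rewrite ler_pdivrMr// mul1r ler_nat.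
Qed.

(** The inner products of [y - x] and of [x - y] with [theta] are opposite, so one of
    them is nonpositive.  Hence two points of [F] whose difference is close to the
    plane would see each other, in one order, in the narrow cone; all differences
    are therefore bounded by their components along the normals. *)
Lemma not_narrow_graph g a theta (F : set 'rV[R]_n) : 0 < g ->
  (forall x y, F x -> F y -> ~ narrow g a theta (y - x)) ->
  exists2 h : 'rV[R]_m -> 'rV[R]_n, lipschitz_map h & F `<=` range h.
Proof.
move=> g0 Fn; apply: (lipschitz_graph_cover (a := a) g0) => x y Fx Fy.
rewrite leNgt; apply/negP => xy.
have small i : `|dotv (x - y) (a i)| <= g * enorm (x - y).
  by apply: le_trans (ltW xy); rewrite (bigD1 i)//= lerDl sumr_ge0.
have xy0 : x - y != 0.
  apply: contraTneq xy => ->; rewrite enorm0 mulr0 -leNgt.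
  by apply: sumr_ge0.
have [xyt|xyt] := leP (dotv (x - y) theta) 0.
  apply: (Fn y x Fy Fx); split => //.
  by apply: le_trans xyt _; rewrite mulr_ge0 ?(ltW g0).
apply: (Fn x y Fx Fy); split; rewrite -?(opprB x y) ?oppr_eq0//.
  by move=> i; rewrite dotvNl normrN enormN.
by rewrite dotvNl enormN (@le_trans _ _ 0)// ?oppr_le0 ?(ltW xyt)// mulr_ge0// ltW.
Qed.

End Narrow.

(** * Null sets and multiplicities *)

Lemma finite_lower_bound {R : realType} (I : finType) (F : I -> R) :
  (forall i, 0 < F i) -> exists2 c, 0 < c & forall i, c <= F i.
Proof.
move=> F0; exists (\big[Num.min/1]_i F i).
  by elim/big_ind: _ => // x y x0 y0; rewrite lt_min x0.
by move=> i; exact: bigmin_le_cond.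
Qed.

Lemma sum_geometric_le {R : realType} (lam : R) N : 0 <= lam < 1 ->
  \sum_(k < N) lam ^+ k <= (1 - lam)^-1.
Proof.
move=> /andP[l0 l1]; have l1' : 0 < 1 - lam by rewrite subr_gt0.
rewrite -[leRHS]mul1r ler_pdivlMr// mulrC -opprB mulNr -subrX1 opprB.
by rewrite gerBl exprn_ge0.
Qed.

Lemma lim_sup_set_geometric d (T : measurableType d) (R : realType)
    (nu : {measure set T -> \bar R}) (F : (set T)^nat) (C lam : R) :
  (forall k, measurable (F k)) -> 0 <= lam < 1 ->
  (forall k, (nu (F k) <= (C * lam ^+ k)%:E)%E) -> nu (lim_sup_set F) = 0%E.
Proof.
move=> mF lam01 FC; apply: lim_sup_set_cvg0 => //.
have C0 : 0 <= C.
  by have := le_trans (measure_ge0 nu (F 0)) (FC 0); rewrite lee_fin expr0 mulr1.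
apply: (@le_lt_trans _ _ (C * (1 - lam)^-1)%:E); last by rewrite ltry.
apply: lime_le; first by apply: is_cvg_nneseries => k _ _.
apply: nearW => N; rewrite big_mkord.
apply: (@le_trans _ _ (\sum_(k < N) (C * lam ^+ k)%:E)); first exact: lee_sum.
by rewrite sumEFin lee_fin -mulr_sumr ler_wpM2l// sum_geometric_le.
Qed.

Lemma measure_bigsetU_le d (T : measurableType d) (R : realType)
    (nu : {measure set T -> \bar R}) (I : Type) (s : seq I) (P : pred I)
    (F : I -> set T) : (forall i, measurable (F i)) ->
  (nu (\big[setU/set0]_(i <- s | P i) F i) <= \sum_(i <- s | P i) nu (F i))%E.
Proof.
move=> mF; elim: s => [|i s IH]; first by rewrite !big_nil measure0.
rewrite !big_cons; case: ifP => // Pi.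
apply: le_trans (measureU2 _ _ _) _ => //; last by rewrite leeD2l.
exact: bigsetU_measurable.
Qed.

(** Integrate the sum of the indicators, which is at most [N] everywhere. *)
Lemma sum_measure_le_multiplicity d (T : measurableType d) (R : realType)
    (mu : {measure set T -> \bar R}) (I : finType) (F : I -> set T) (N : nat) :
  (forall i, measurable (F i)) -> mu setT = 1%E ->
  (forall x, (#|[pred i | x \in F i]| <= N)%N) ->
  (\sum_i mu (F i) <= N%:R%:E)%E.
Proof.
move=> mF mu1 FN.
have -> : (\sum_i mu (F i) = \int[mu]_x \sum_i (\1_(F i) x)%:E)%E.
  rewrite ge0_integral_sum//.
  - by apply: eq_bigr => i _; rewrite integral_indic// setIT.
  - by move=> i; apply/measurable_EFinP; exact: measurable_indic.
apply: (@le_trans _ _ (\int[mu]_x (N%:R)%:E)%E); last first.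
  by rewrite integral_cst// mu1 mule1.
apply: ge0_le_integral => //.
- by move=> x _; apply: sume_ge0 => i _; rewrite lee_fin.
- by apply: emeasurable_sum => i; apply/measurable_EFinP; exact: measurable_indic.
- move=> x _; rewrite sumEFin lee_fin.
  rewrite (eq_bigr (fun i => if x \in F i then 1 else 0)); last first.
    by move=> i _; rewrite indicE; case: (x \in F i).
  by rewrite -big_mkcond/= sumr_const ler_nat; exact: FN.
Qed.

Lemma geometric_small {R : realType} (b D c : R) : 0 <= b < 1 -> 0 < c ->
  exists k, b ^+ k * D <= c.
Proof.
move=> /andP[b0 b1] c0.
have : b ^+ k * D @[k --> \oo] --> 0 * D.
  by apply: cvgMl; apply: cvg_expr; rewrite ger0_norm.
rewrite mul0r => /cvgrPdist_le/(_ _ c0)[k _ /(_ k (leqnn k))].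
rewrite sub0r normrN => h; exists k; exact: le_trans (ler_norm _) h.
Qed.

Lemma measurable_open {R : realType} {n : nat} (A : set 'rV[R]_n) :
  open A -> measurable (A : set (borel_rV R n)).
Proof. by move=> oA; apply: sub_gen_smallest. Qed.

Lemma measurable_closed {R : realType} {n : nat} (A : set 'rV[R]_n) :
  closed A -> measurable (A : set (borel_rV R n)).
Proof.
move=> cA; rewrite -[A]setCK; apply: measurableC; apply: measurable_open.
exact: closed_openC.
Qed.

(** * Words and pieces *)

Definition word_prod {R : realType} {kappa : nat} (q : 'I_kappa -> R)
    (w : seq 'I_kappa) : R :=
  \prod_(i <- w) q i.

Definition piece {R : realType} {n kappa : nat} (f : 'I_kappa -> 'rV[R]_n -> 'rV[R]_n)
    (E : set 'rV[R]_n) (w : seq 'I_kappa) : set 'rV[R]_n :=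
  comp_word f w @` E.

Section Words.
Context {R : realType} {kappa : nat}.
Implicit Types (q : 'I_kappa -> R) (u v w : seq 'I_kappa).

Lemma word_prod_cat q u v : word_prod q (u ++ v) = word_prod q u * word_prod q v.
Proof. by rewrite /word_prod big_cat. Qed.

Lemma word_prod_le q w b : (forall i, 0 <= q i <= b) -> word_prod q w <= b ^+ size w.
Proof.
move=> qb; rewrite /word_prod; elim: w => [|i w IH]; first by rewrite big_nil.
rewrite big_cons exprS; have /andP[q0 qi] := qb i.
by apply: ler_pM => //; apply: prodr_ge0 => j _; have /andP[] := qb j.
Qed.

Lemma word_prod_ge q w b : 0 <= b -> (forall i, i \in w -> b <= q i) ->
  b ^+ size w <= word_prod q w.
Proof.
move=> b0; rewrite /word_prod; elim: w => [|i w IH] qb; first by rewrite big_nil.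
rewrite big_cons exprS; apply: ler_pM; rewrite ?exprn_ge0//.
  by apply: qb; rewrite mem_head.
by apply: IH => j jw; apply: qb; rewrite in_cons jw orbT.
Qed.

Lemma word_prod_gt0 q w : (forall i, 0 < q i) -> 0 < word_prod q w.
Proof. by move=> q0; apply: prodr_gt0 => i _. Qed.

Lemma word_prod_ge0 q w : (forall i, 0 <= q i) -> 0 <= word_prod q w.
Proof. by move=> q0; apply: prodr_ge0 => i _. Qed.

Lemma word_prod_neq0 q w i : word_prod q w != 0 -> i \in w -> q i != 0.
Proof.
rewrite /word_prod prodf_seq_neq0 => /allP h /h; by [].
Qed.

Lemma sum_tupleS k (F : seq 'I_kappa -> R) :
  \sum_(w : k.+1.-tuple 'I_kappa) F w =
  \sum_(i : 'I_kappa) \sum_(w : k.-tuple 'I_kappa) F (i :: w).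
Proof.
rewrite pair_big/=.
rewrite (reindex (fun x : 'I_kappa * k.-tuple 'I_kappa => [tuple of x.1 :: x.2]))//=.
exists (fun w : k.+1.-tuple 'I_kappa => (thead w, [tuple of behead w])) => [[i w] _|w _].
  by rewrite /= theadE; congr (_, _); apply: val_inj.
by rewrite -tuple_eta.
Qed.

Lemma sum_word_prod q k : \sum_i q i = 1 ->
  \sum_(w : k.-tuple 'I_kappa) word_prod q w = 1.
Proof.
move=> q1; elim: k => [|k IH].
  rewrite (big_pred1 [tuple])/=; first by rewrite /word_prod big_nil.
  by move=> t; apply/esym/eqP; exact: tuple0.
rewrite (sum_tupleS _ (word_prod q)) -[RHS]q1; apply: eq_bigr => i _.
under eq_bigr do rewrite /word_prod big_cons.
by rewrite -mulr_sumr -[X in _ * X]/(\sum_(w : k.-tuple _) word_prod q w) IH mulr1.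
Qed.

Lemma comparable_length q (b r : R) w K : 0 < r <= 1 -> b ^+ K < r -> (K <= size w)%N ->
  (forall i, 0 <= q i <= b) ->
  exists2 k, (k < K)%N & r <= word_prod q (take k w) /\ word_prod q (take k.+1 w) < r.
Proof.
move=> /andP[r0 r1] bK Kw rb.
have ex : exists k, word_prod q (take k w) < r.
  exists K; apply: le_lt_trans bK; rewrite -{2}(size_takel Kw).
  exact: word_prod_le.
case: (ex_minnP ex) => -[|k]; first by rewrite take0 /word_prod big_nil ltNge r1.
move=> kr kmin; exists k; last first.
  by split => //; rewrite leNgt; apply/negP => /kmin; rewrite ltnn.
apply: kmin; apply: le_lt_trans bK; rewrite -{2}(size_takel Kw).
exact: word_prod_le.
Qed.

End Words.

Section IFS.
Context {R : realType} {n kappa : nat}.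
Context (f : 'I_kappa -> 'rV[R]_n -> 'rV[R]_n) (rho : 'I_kappa -> R).
Context (hf : contracting_similarities f rho).
Implicit Types (u v w : seq 'I_kappa).

Lemma comp_word_cat u v x : comp_word f (u ++ v) x = comp_word f u (comp_word f v x).
Proof. by elim: u => //= i u ->. Qed.

Lemma comp_word_similarity w x y :
  enorm (comp_word f w x - comp_word f w y) = word_prod rho w * enorm (x - y).
Proof.
elim: w => [|i w IH] /=; first by rewrite /word_prod big_nil mul1r.
by rewrite (hf i).2 IH /word_prod big_cons mulrA.
Qed.

Lemma ratio_gt0 w : 0 < word_prod rho w.
Proof. by apply: word_prod_gt0 => i; have /andP[] := (hf i).1. Qed.

Lemma comp_word_affine w : exists2 O : 'M[R]_n, O *m O^T = 1%:M &
  forall x y, comp_word f w x - comp_word f w y = word_prod rho w *: ((x - y) *m O).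
Proof. by apply: similarity_affine (ratio_gt0 w) _; exact: comp_word_similarity. Qed.

(** Similarities are onto, so the image of a ball is a full ball. *)
Lemma comp_word_ball w x (c : R) y :
  enorm (y - comp_word f w x) <= c * word_prod rho w ->
  exists2 z, enorm (z - x) <= c & y = comp_word f w z.
Proof.
move=> yx; have r0 := ratio_gt0 w.
have [ O OO fO] := comp_word_affine w.
have rV : word_prod rho w * (word_prod rho w)^-1 = 1 by rewrite mulfV ?gt_eqF.
exists (x + (word_prod rho w)^-1 *: ((y - comp_word f w x) *m O^T)); last first.
  apply: (addIr (- comp_word f w x)); rewrite fO (addrC x) addrK -scalemxAl.
  by rewrite scalerA rV scale1r -mulmxA (mulmx1C OO) mulmx1.
rewrite (addrC x) addrK -(ler_pM2r r0) (le_trans _ yx)//.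
rewrite enormZ gtr0_norm ?invr_gt0// mulrC mulrA rV mul1r.
rewrite le_eqVlt; apply/orP; left; apply/eqP.
by rewrite /enorm dotv_mulmx trmxK -mulmxA (mulmx1C OO) mulmx1.
Qed.

(** The disjointness of the images of [U] passes from letters to words of equal
    length: strip the common first letters, and compare the first different ones. *)
Lemma open_set_words (U : set 'rV[R]_n) u v : \bigcup_i f i @` U `<=` U ->
  trivIset setT (fun i => f i @` U) -> size u = size v -> u != v ->
  comp_word f u @` U `&` comp_word f v @` U = set0.
Proof.
move=> fU tU.
have fwU w x : U x -> U (comp_word f w x).
  by elim: w => //= i w IH /IH Uwx; apply: fU; exists i => //; exists (comp_word f w x).
elim: u v => [|i u IH] [|j v]//= [uv] neq; apply/seteqP; split=> // y.
case=> -[x Ux <-] /= [x' Ux' fE].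
have [ij|ij] := eqVneq i j.
  have : f i (comp_word f u x) = f i (comp_word f v x') by rewrite -fE ij.
  move/(congr1 (fun z => enorm (z - f i (comp_word f v x')))).
  have /andP[r0 _] := (hf i).1.
  rewrite subrr enorm0 (hf i).2 => /eqP; rewrite mulf_eq0 gt_eqF//=.
  move=> /eqP/enorm_eq0/eqP; rewrite subr_eq0 => /eqP fuv.
  have uv' : u != v by apply: contra neq => /eqP ->; rewrite ij.
  suff : set0 (comp_word f u x) by [].
  rewrite -(IH v uv uv'); split; first by exists x.
  by exists x'.
suff : set0 (f i (comp_word f u x)) by [].
have /trivIsetP/(_ i j I I ij) <- := tU; split.
  by exists (comp_word f u x) => //; exact: fwU.
by exists (comp_word f v x') => //; exact: fwU.
Qed.

Context (E : set 'rV[R]_n) (hE : self_similar_set f E).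

Lemma piece_sub w : piece f E w `<=` E.
Proof.
case: hE => _ _ EE _ [x Ex <-].
elim: w => //= i w IH; rewrite EE; exists i => //.
Qed.

Lemma piece_cat u v : piece f E (u ++ v) `<=` piece f E u.
Proof.
move=> _ [x Ex <-]; rewrite comp_word_cat; exists (comp_word f v x) => //.
by apply: (@piece_sub v); exists x.
Qed.

Lemma piece_cat_preimage u v x : piece f E (u ++ v) x ->
  exists2 y, piece f E v y & x = comp_word f u y.
Proof.
move=> [y Ey <-]; exists (comp_word f v y); first by exists y.
by rewrite comp_word_cat.
Qed.

Lemma closed_piece w : closed (piece f E w).
Proof.
case: hE => _ cE _; apply: compact_closed; first exact: norm_hausdorff.
apply: continuous_compact => //; apply: continuous_subspaceT.
apply: (@lipschitz_continuous _ _ _ _ (word_prod rho w)) => x y.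
by rewrite comp_word_similarity.
Qed.

Lemma attractor_bounded : exists2 D, 0 < D & forall x y, E x -> E y -> enorm (x - y) <= D.
Proof.
case: hE => _ /compact_bounded[M [_ MM]] _.
have EM x : E x -> `|x| <= M + 1 by apply: MM; rewrite ltrDl.
exists (n%:R * (2 * `|M + 1|) + 1); first by rewrite ltr_wpDl// !mulr_ge0.
move=> x y Ex Ey; rewrite (le_trans (enorm_le_norm _))// ler_wpDr//.
rewrite ler_wpM2l// (le_trans (ler_normB _ _))// mulr2n mulrDl !mul1r.
by apply: lerD; apply: le_trans (ler_norm _); exact: EM.
Qed.

Lemma piece_diam D w x y : (forall x y, E x -> E y -> enorm (x - y) <= D) ->
  piece f E w x -> piece f E w y -> enorm (x - y) <= word_prod rho w * D.
Proof.
move=> ED [x' Ex <-] [y' Ey <-]; rewrite comp_word_similarity.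
by rewrite ler_wpM2l ?ED// ltW// ratio_gt0.
Qed.

Lemma ratio_bounds : exists a b : R, [/\ 0 < a, 0 < b < 1, forall i, a <= rho i &
  forall i, rho i <= b].
Proof.
have [a a0 ah] := @finite_lower_bound R 'I_kappa rho (fun i => proj1 (andP (hf i).1)).
have [i|b b0 bh] := @finite_lower_bound R 'I_kappa (fun i => 1 - rho i).
  by rewrite subr_gt0; have /andP[] := (hf i).1.
exists a, (Num.max (1 - b) (2^-1)); split => //.
  rewrite lt_max invr_gt0 ltr0n orbT/= gt_max invf_lt1 ?ltr1n// andbT.
  by rewrite gtrBl.
by move=> i; rewrite le_max lerBrDr -lerBrDl bh.
Qed.

End IFS.

(** The centre is the image of a point of the open set, not of [E]: around it there
    is room of size comparable to the ratio. *)
Definition word_ball {R : realType} {n kappa : nat} (f : 'I_kappa -> 'rV[R]_n -> 'rV[R]_n)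
    (rho : 'I_kappa -> R) (y0 : 'rV[R]_n) (C : R) (w : seq 'I_kappa) : set 'rV[R]_n :=
  eball (comp_word f w y0) (C * word_prod rho w).

Section BallMultiplicity.
Context {R : realType} {n kappa : nat}.
Context {f : 'I_kappa -> 'rV[R]_n -> 'rV[R]_n} {rho : 'I_kappa -> R}.
Context (hf : contracting_similarities f rho).
Context {U : set 'rV[R]_n} (fU : \bigcup_i f i @` U `<=` U).
Context (tU : trivIset setT (fun i => f i @` U)).
Context {y0 : 'rV[R]_n} {c : R} (c0 : 0 < c) (cU : eball y0 c `<=` U).
Implicit Types (u v w : seq 'I_kappa) (x : 'rV[R]_n).

Lemma center_separation u v : size u = size v -> u != v ->
  c * word_prod rho u < enorm (comp_word f v y0 - comp_word f u y0).
Proof.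
move=> uv neq; rewrite ltNge; apply/negP => /(comp_word_ball hf)[z zy0 vz].
suff : set0 (comp_word f v y0) by [].
rewrite -(open_set_words hf fU tU uv neq); split; last first.
  by exists y0 => //; apply: cU; rewrite /eball/= subrr enorm0 ltW.
by exists z => //; exact: cU.
Qed.

Lemma same_cell (d a b : R) : 0 < d -> 0 <= a -> 0 <= b ->
  Num.truncn (a / d) = Num.truncn (b / d) -> `|a - b| <= d.
Proof.
move=> d0 a0 b0 ab.
have := truncn_itv (divr_ge0 a0 (ltW d0)); have := truncn_itv (divr_ge0 b0 (ltW d0)).
rewrite ab -!natr1; set t := (Num.truncn _)%:R => /andP[b1 b2] /andP[a1 a2].
move: b1 b2 a1 a2; rewrite !ler_pdivlMr// !ltr_pdivrMr// mulrDl mul1r => b1 b2 a1 a2.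
by rewrite ler_norml; lra.
Qed.

(** The centres of comparable balls are separated, by the open set condition, so
    boundedly many of them fit around a point.  Words of length [k] realise only
    [O(k)] logarithmic scales.  The counting maps a word to its scale and to the
    cell of its centre in a grid of that scale. *)
Lemma word_ball_multiplicity (C : R) : 0 < C ->
  exists N : nat, forall k x,
  (#|[pred w : k.-tuple 'I_kappa | x \in word_ball f rho y0 C w]| <= N * k.+1)%N.
Proof.
move=> C0; have [a [b [a0 _ ra rb]]] := ratio_bounds hf.
pose A := (Num.truncn (- ln a)).+1.
have e0 := expR_gt0 (1 : R).
(* Two centres of the same scale in the same cell of size [d * h] are closer than
   [c * h / expR 1], which is at most [c] times the ratio. *)
pose d := c / (n.+1%:R * expR 1).
have d0 : 0 < d by rewrite divr_gt0// mulr_gt0.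
pose M := Num.truncn (2 * C / d).
exists (A.+1 * M.+1 ^ n)%N => k x.
(* The ratio of [w] lies between [h w / expR 1] and [h w]. *)
pose bin (w : seq 'I_kappa) := Num.truncn (- ln (word_prod rho w)).
pose h (w : seq 'I_kappa) : R := expR (- (bin w)%:R).
pose cell (w : seq 'I_kappa) i :=
  Num.truncn (((comp_word f w y0 - x) ord0 i / h w + C) / d).
have r0 w := ratio_gt0 hf w.
have r1 w : word_prod rho w <= 1.
  rewrite -(expr1n _ (size w)); apply: word_prod_le => i.
  by have /andP[ri0 ri1] := (hf i).1; rewrite !ltW.
have lnr0 w : 0 <= - ln (word_prod rho w) by rewrite oppr_ge0 ln_le0.
have rE w : word_prod rho w = expR (ln (word_prod rho w)) by rewrite lnK// posrE.
have rh w : word_prod rho w <= h w.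
  rewrite /h {1}rE ler_expR lerNr.
  by have /andP[] := truncn_itv (lnr0 w).
have hr w : h w <= expR 1 * word_prod rho w.
  rewrite [X in _ * X]rE -expRD ler_expR.
  have /andP[_] := truncn_itv (lnr0 w); rewrite -/(bin w) -natr1; lra.
have h0 w : 0 < h w by exact: expR_gt0.
have binA (w : k.-tuple 'I_kappa) : (bin w < (A * k).+1)%N.
  rewrite ltnS -(@ler_nat R) (@le_trans _ _ (- ln (word_prod rho w)))//.
    by have /andP[] := truncn_itv (lnr0 w).
  apply: (@le_trans _ _ (- ln (a ^+ k))).
    rewrite lerN2 ler_ln ?posrE ?exprn_gt0//.
    by rewrite -{1}(size_tuple w); apply: word_prod_ge => [|i _]; [exact: ltW|exact: ra].
  rewrite lnXn// -mulNrn -[(- ln a) *+ k]mulr_natr natrM. rewrite ler_wpM2r//.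
  rewrite ltW//; apply: truncnS_gt.
have coordh (w : k.-tuple 'I_kappa) i : x \in word_ball f rho y0 C w ->
    - C <= (comp_word f w y0 - x) ord0 i / h w <= C.
  rewrite inE /word_ball /eball/= enormC => xw.
  rewrite -ler_norml normrM normfV (gtr0_norm (h0 w)) ler_pdivrMr//.
  rewrite (le_trans (norm_coord_le _ i))// (le_trans xw)//.
  by rewrite ler_wpM2l ?(ltW C0).
have cellM (w : k.-tuple 'I_kappa) i :
    x \in word_ball f rho y0 C w -> (cell w i < M.+1)%N.
  move=> /(coordh _ i)/andP[h1 h2]; rewrite ltnS; apply: le_truncn.
  by rewrite ler_pM2r ?invr_gt0//; lra.
pose g (w : k.-tuple 'I_kappa) : 'I_(A * k).+1 * {ffun 'I_n -> 'I_M.+1} :=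
  (inord (bin w), [ffun i => inord (cell w i)]).
have g_inj :
    {in [pred w : k.-tuple 'I_kappa | x \in word_ball f rho y0 C w] &, injective g}.
  move=> w v wI vI; have xw : x \in word_ball f rho y0 C w := wI.
  have xv : x \in word_ball f rho y0 C v := vI.
  case=> /(congr1 val); rewrite /= !inordK// => wv /ffunP gwv.
  apply/eqP/negPn/negP => neq.
  have := @center_separation v w; rewrite !size_tuple eq_sym => /(_ erefl neq).
  apply/negP; rewrite -leNgt.
  have hwv : h w = h v by rewrite /h wv.
  apply: (@le_trans _ _ (\sum_(i < n) d * h v)).
    apply: le_trans (enorm_le_sum _) _; apply: ler_sum => i _.
    have := gwv i; rewrite !ffunE => /(congr1 val); rewrite /= !inordK ?cellM//.
    have /andP[w1 _] := coordh _ i xw; have /andP[v1 _] := coordh _ i xv.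
    move=> /same_cell-/(_ d0); rewrite -!lerBlDr !sub0r => /(_ w1 v1).
    rewrite opprD addrACA subrr addr0 hwv -mulrBl normrM normfV (gtr0_norm (h0 v)).
    by rewrite ler_pdivrMr//; congr (`|_| <= _); rewrite !mxE; ring.
  rewrite sumr_const card_ord -mulr_natl /d.
  apply: (@le_trans _ _ (n.+1%:R * (c / (n.+1%:R * expR 1) * h v))).
    by rewrite ler_wpM2r ?ler_nat// mulr_ge0 ?ltW.
  have -> : n.+1%:R * (c / (n.+1%:R * expR 1) * h v) = c * (h v / expR 1).
    by field; rewrite gt_eqF//= nat1r.
  by rewrite ler_wpM2l ?(ltW c0)// ler_pdivrMr// mulrC.
rewrite -(card_in_imset g_inj) (leq_trans (max_card _))//.
rewrite card_prod card_ffun !card_ord mulnAC leq_mul2r; apply/orP; right.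
by rewrite mulnS mulSn addSn ltnS addnA leq_addl.
Qed.

End BallMultiplicity.

(** * Rare words *)

Lemma bernoulli_ineq {R : realType} (t : R) k : 1 <= t -> 1 + k%:R * (t - 1) <= t ^+ k.
Proof.
move=> t1; elim: k => [|k IH]; first by rewrite mul0r addr0.
have : t * (1 + k%:R * (t - 1)) <= t * t ^+ k by rewrite ler_wpM2l//; lra.
rewrite exprS; apply: le_trans; rewrite -natr1.
have : 0 <= k%:R * (t - 1) ^+ 2 by rewrite mulr_ge0// sqr_ge0.
nra.
Qed.

Section RareWords.
Context {R : realType} {kappa : nat}.
Context {p : 'I_kappa -> R} (p0 : forall i, 0 <= p i) (p1 : \sum_i p i = 1).
Implicit Types (u v w : seq 'I_kappa).

Let mass_ge0 w : 0 <= word_prod p w. Proof. exact: word_prod_ge0. Qed.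

(** On the words in question [word_prod p w] is at most [t ^- (2 * k)] times the mass
    of [B w], and the masses of all [B w] add up to at most [N * k.+1].  One of the
    two factors [t ^- k] absorbs [k.+1]. *)
Lemma sum_heavy_ball_words {n : nat} (mu : {measure set borel_rV R n -> \bar R})
    (B : seq 'I_kappa -> set (borel_rV R n)) (N : nat) (t : R) : 1 < t ->
  (forall w, measurable (B w)) -> mu setT = 1%E ->
  (forall k x, (#|[pred w : k.-tuple 'I_kappa | x \in B w]| <= N * k.+1)%N) ->
  exists C, forall k,
  \sum_(w : k.-tuple 'I_kappa | ((t ^+ (2 * size w) * word_prod p w)%:E < mu (B w))%E)
    word_prod p w <= C * t^-1 ^+ k.
Proof.
move=> t1 mB mu1 BN; have t0 : 0 < t by lra.
exists (N%:R * (1 + (t - 1)^-1)) => k.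
have tk0 : 0 < t ^+ k by rewrite exprn_gt0.
have t2k0 : 0 < t ^+ (2 * k) by rewrite exprn_gt0.
rewrite -(ler_pM2l t2k0) mulr_sumr -lee_fin.
apply: (@le_trans _ _ (\sum_(w : k.-tuple 'I_kappa) mu (B w))%E).
  rewrite -sumEFin big_mkcond/=; apply: lee_sum => w _.
  by case: ifPn => // /ltW; rewrite size_tuple.
apply: le_trans (sum_measure_le_multiplicity _ mu1 (BN k)) _ => //.
rewrite lee_fin natrM mul2n -addnn exprD exprVn.
have -> : t ^+ k * t ^+ k * (N%:R * (1 + (t - 1)^-1) / t ^+ k) =
   N%:R * ((1 + (t - 1)^-1) * t ^+ k).
  by field; rewrite expf_neq0 ?gt_eqF//=; lra.
rewrite ler_wpM2l// -natr1.
have s0 : 0 < (t - 1)^-1 by rewrite invr_gt0; lra.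
have ts : (t - 1)^-1 * (t - 1) = 1 by rewrite mulVf// subr_eq0 gt_eqF.
have k0 : 0 <= k%:R :> R by [].
have := ler_wpM2l (ltW (ltr_wpDl ler01 s0)) (bernoulli_ineq k (ltW t1)).
have : 0 <= k%:R * (t - 1) by rewrite mulr_ge0//; lra.
set s := (t - 1)^-1 in s0 ts * => h0; apply: le_trans.
have -> : (1 + s) * (1 + k%:R * (t - 1)) = 1 + k%:R * (t - 1) + s + k%:R * (s * (t - 1)).
  by ring.
rewrite ts; lra.
Qed.

Lemma sum_tuple_cat k l (F : seq 'I_kappa -> R) :
  \sum_(w : (k + l).-tuple 'I_kappa) F w =
  \sum_(u : k.-tuple 'I_kappa) \sum_(v : l.-tuple 'I_kappa) F (u ++ v).
Proof.
elim: k F => [|k IH] F.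
  rewrite (big_pred1 [tuple])//= => u; apply/esym/eqP; exact: tuple0.
rewrite addSn !sum_tupleS.
rewrite (sum_tupleS _ (fun u => \sum_(v : l.-tuple 'I_kappa) F (u ++ v))).
by apply: eq_bigr => i _; rewrite (IH (fun w => F (i :: w))).
Qed.

(** Only the occurrences of [w0] that are aligned with the blocks count, because
    disjoint blocks are independent. *)
Fixpoint avoids (w0 : seq 'I_kappa) (q : nat) (w : seq 'I_kappa) : bool :=
  if q is q'.+1 then
    (take (size w0) w != w0) && avoids w0 q' (drop (size w0) w)
  else true.

Lemma avoidsN w0 q w : ~~ avoids w0 q w ->
  exists2 i, (i < q)%N & take (size w0) (drop (i * size w0) w) = w0.
Proof.
elim: q w => //= q IH w; rewrite negb_and negbK => /orP[/eqP h|/IH[i iq h]].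
  by exists 0%N; rewrite // mul0n drop0.
by exists i.+1; rewrite // mulSn addnC -drop_drop.
Qed.

(** The blocks of a random word are independent, and each of them differs from [w0]
    with probability [1 - word_prod p w0]. *)
Lemma sum_avoids w0 q :
  \sum_(w : (q * size w0).-tuple 'I_kappa | avoids w0 q w) word_prod p w =
  (1 - word_prod p w0) ^+ q.
Proof.
rewrite big_mkcond/=; elim: q => [|q IH].
  rewrite (big_pred1 [tuple])/=; first by rewrite /word_prod big_nil.
  by move=> u; apply/esym/eqP; exact: tuple0.
rewrite mulSn (sum_tuple_cat _ _
  (fun w => if avoids w0 q.+1 w then word_prod p w else 0)).
rewrite exprS.
have sumN : \sum_(u : (size w0).-tuple 'I_kappa | u != in_tuple w0) word_prod p u =
    1 - word_prod p w0.
  have := sum_word_prod (size w0) p1; rewrite (bigD1 (in_tuple w0))//= => <-.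
  by rewrite addrAC subrr add0r.
rewrite -{1}sumN mulr_suml (bigD1 (in_tuple w0))//=.
rewrite big1 ?add0r.
  apply: eq_bigr => u uw0; rewrite -IH mulr_sumr; apply: eq_bigr => v _.
  rewrite take_size_cat ?size_tuple// drop_size_cat ?size_tuple//.
  have -> : (tval u != w0) by apply: contra uw0 => /eqP h; apply/eqP; exact: val_inj.
  by rewrite /= word_prod_cat; case: ifP; rewrite ?mulr0.
by move=> v _; rewrite take_size_cat// eqxx.
Qed.

(** The window of the last [q * size w0] letters starts after at least [q * Q]
    letters.  So its length is at most [size w0 / Q] times the position where it
    starts, while [q] still grows linearly with the length of the word. *)
Definition late_gap (w0 : seq 'I_kappa) (Q : nat) (w : seq 'I_kappa) : bool :=
  let q := (size w %/ (Q + size w0))%N in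
  avoids w0 q (drop (size w - q * size w0) w).

Lemma sum_late_gap_le w0 Q k :
  \sum_(w : k.-tuple 'I_kappa | late_gap w0 Q w) word_prod p w <=
  (1 - word_prod p w0) ^+ (k %/ (Q + size w0)).
Proof.
set q := (k %/ _)%N; pose l := (k - q * size w0)%N.
have kE : k = (l + q * size w0)%N.
  rewrite subnK//; apply: leq_trans (leq_divM k (Q + size w0)).
  by rewrite leq_mul2l leq_addl orbT.
rewrite (eq_bigl (fun w : k.-tuple 'I_kappa => avoids w0 q (drop l w))); last first.
  by move=> w; rewrite /late_gap size_tuple.
clearbody l; clearbody q; rewrite big_mkcond kE /=.
rewrite (sum_tuple_cat _ _
  (fun w => if avoids w0 q (drop l w) then word_prod p w else 0)).
rewrite -[leRHS]mul1r -[X in X * _](sum_word_prod l p1) mulr_suml; apply: ler_sum => u _.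
rewrite -sum_avoids mulr_sumr [leRHS]big_mkcond/=; apply: ler_sum => v _.
by rewrite drop_size_cat ?size_tuple// word_prod_cat.
Qed.

Lemma sum_late_gap w0 Q : (0 < Q)%N -> 0 < word_prod p w0 ->
  exists C lam, 0 <= lam < 1 /\ forall k,
  \sum_(w : k.-tuple 'I_kappa | late_gap w0 Q w) word_prod p w <= C * lam ^+ k.
Proof.
move=> Q0 w0p; pose M := (Q + size w0)%N.
have M0 : (0 < M)%N by rewrite addn_gt0 Q0.
pose b := Num.max (1 - word_prod p w0) (2^-1).
have b0 : 0 < b by rewrite lt_max invr_gt0 ltr0n orbT.
have b1 : b < 1 by rewrite gt_max invf_lt1 ?ltr1n// andbT gtrBl.
(* The [M]-th root turns the bound [b ^+ (k %/ M)] into a bound by [lam ^+ k]. *)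
pose lam := b `^ (M%:R^-1).
have lamM : lam ^+ M = b.
  by rewrite -powR_mulrn ?powR_ge0// /lam -powRrM mulVf ?powRr1 ?pnatr_eq0 -?lt0n// ltW.
have lam0 : 0 < lam by exact: powR_gt0.
have lam1 : lam < 1.
  by rewrite ltNge; apply/negP => /(exprn_ege1 M); rewrite lamM leNgt b1.
exists (b^-1), lam; split; first by rewrite ltW.
move=> k; apply: le_trans (sum_late_gap_le _ _ _) _.
have wp1 : word_prod p w0 <= 1.
  rewrite -(expr1n _ (size w0)); apply: word_prod_le => i; rewrite p0/= -p1.
  by rewrite (bigD1 i)//= lerDl sumr_ge0.
apply: (@le_trans _ _ (b ^+ (k %/ M))).
  by rewrite lerXn2r ?nnegrE ?subr_ge0 ?(ltW b0)// le_max lexx.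
rewrite ler_pdivlMl// mulrC -exprSr -lamM -exprM.
by rewrite ler_wiXn2l ?(ltW lam0) ?(ltW lam1)// mulnC ltnW// ltn_ceil.
Qed.

End RareWords.

(** The test [late_gap] is applied to the prefix of [w] whose tested window starts
    exactly at the position [k + l]. *)
Lemma next_occurrence {kappa : nat} (w0 w : seq 'I_kappa) (Q j k l : nat) :
  (0 < Q)%N -> (j <= k)%N ->
  (k + l + (k + l) %/ Q * size w0 <= size w)%N ->
  (forall i, (j <= i <= size w)%N -> ~~ late_gap w0 Q (take i w)) ->
  exists s s', w = take k w ++ s ++ w0 ++ s' /\
    (l <= size s <= l + (k + l) %/ Q * size w0)%N.
Proof.
move=> Q0 jk; set q := ((k + l) %/ Q)%N; set L := size w0.
set k' := (k + l + q * L)%N => kw gap.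
have k'E : (k' %/ (Q + L))%N = q.
  rewrite /k' (divn_eq (k + l) Q) -/q addnAC -mulnDr divnMDl ?addn_gt0 ?Q0//.
  by rewrite divn_small ?addn0// ltn_addr// ltn_pmod.
have := gap k'; rewrite kw andbT /late_gap size_takel// k'E addnK => /(_ _)/avoidsN.
case; first by rewrite /k'; lia.
move=> i iq; rewrite -/L drop_drop => w0E.
have iL : (i * L + L <= q * L)%N by rewrite -mulSnr leq_mul2r iq orbT.
have {}w0E : take L (drop (i * L + (k + l)) w) = w0.
  rewrite -[RHS]w0E !take_drop take_takel//; rewrite /k'; lia.
exists (take (l + i * L) (drop k w)), (drop (L + (i * L + (k + l))) w); split.
  rewrite -{1}(cat_take_drop k w); congr cat.
  rewrite -{1}(cat_take_drop (l + i * L) (drop k w)); congr cat.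
  rewrite drop_drop (_ : l + i * L + k = i * L + (k + l))%N; last by lia.
  by rewrite -{1}(cat_take_drop L (drop _ w)) w0E drop_drop.
rewrite size_takel; first by lia.
by rewrite size_drop; lia.
Qed.

(** A delay of [l + q * L] letters costs at most the factor [pm ^+ (l + q * L)], and
    the excess mass of a ball at most [t ^+ (2 * k)].  As [q] is about [k / Q], both
    are exponential in [k] with rates as small as desired, while [r `^ delta] decays
    at least like [b `^ delta ^+ k]; each of the two is given half of that rate. *)
Lemma exponent_choice {R : realType} (b pm delta : R) (l L : nat) :
  0 < b < 1 -> 0 < pm <= 1 -> 0 < delta ->
  exists t Q c, [/\ 1 < t, (0 < Q)%N, 0 < c & forall k r, 0 < r <= b ^+ k ->
    c * r `^ delta * t ^+ (2 * k) <= pm ^+ (l + (k + l) %/ Q * L)].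
Proof.
move=> /andP[b0 b1] /andP[pm0 pm1] d0.
pose s := delta * - ln b / 4.
have lnb : 0 < - ln b by rewrite oppr_gt0 ln_lt0 ?b0.
have s0 : 0 < s by rewrite divr_gt0// mulr_gt0.
pose be := - ln pm.
have be0 : 0 <= be by rewrite oppr_ge0 ln_le0.
have pmE : pm = expR (- be) by rewrite opprK lnK.
pose Q := (Num.truncn (be * L%:R / (2 * s))).+1.
have QL : be * L%:R <= 2 * s * Q%:R.
  by rewrite [leRHS]mulrC -ler_pdivrMr ?mulr_gt0// ltW// truncnS_gt.
exists (expR s), Q, (expR (- (be + 2 * s) * l%:R)); split; rewrite ?expR_gt1 ?expR_gt0//.
move=> k r /andP[r0 rb].
have lnr : ln r <= k%:R * ln b.
  by rewrite mulr_natl -lnXn// ler_ln ?posrE ?exprn_gt0.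
rewrite /powR gt_eqF// pmE -!expRM_natl -!expRD ler_expR.
have q0 : be * (((k + l) %/ Q)%:R * L%:R) <= 2 * s * (k%:R + l%:R).
  apply: (@le_trans _ _ (2 * s * (Q%:R * ((k + l) %/ Q)%:R))).
    rewrite mulrCA [leRHS]mulrA [leRHS]mulrC ler_wpM2l//.
  apply: ler_wpM2l; first by rewrite mulr_ge0// ltW.
  by rewrite -natrM -natrD ler_nat mulnC leq_divM.
have dr : delta * ln r <= - (4 * s * k%:R).
  have -> : - (4 * s * k%:R) = delta * (k%:R * ln b) by rewrite /s; field.
  by rewrite ler_pM2l.
rewrite natrD !natrM; lra.
Qed.

Lemma positive_lower_bound {R : realType} {kappa : nat} (p : 'I_kappa -> R) :
  probability_vector p -> exists2 b, 0 < b <= 1 & forall i, p i != 0 -> b <= p i.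
Proof.
move=> hp.
have [|b b0 bp] := @finite_lower_bound R _ (fun i => if p i == 0 then 1 else p i).
  by move=> i; case: ifPn => // pi0; rewrite lt0r pi0 hp.1.
exists (Num.min b 1); first by rewrite lt_min b0 ltr01 ge_min lexx orbT.
by move=> i pi0; have := bp i; rewrite (negbTE pi0) ge_min => ->.
Qed.

(** * Cones *)

Section ConeSets.
Context {R : realType} {n : nat}.
Implicit Types (x y z theta : 'rV[R]_n) (V : {vspace 'rV[R]_n}).

Lemma open_lipschitz_lt0 (h : 'rV[R]_n -> R) (L : R) :
  (forall x y, `|h x - h y| <= L * enorm (x - y)) -> open [set y | h y < 0].
Proof.
move=> hL; rewrite (_ : [set y | _] = h @^-1` [set s | s < 0])//.
apply: open_comp; last exact: open_lt.
by move=> y _; exact: (continuous_of_lipschitz hL).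
Qed.

Lemma open_xcone x V (alpha : R) : open (xcone x V alpha).
Proof.
pose h y := edist_vspace (y - x) V - alpha * enorm (y - x).
have -> : xcone x V alpha = [set y | h y < 0].
  by apply/seteqP; split => y; rewrite /xcone /h/= subr_lt0.
apply: (@open_lipschitz_lt0 _ (1 + `|alpha|)) => y z; rewrite /h.
have yz : y - x - (z - x) = y - z by rewrite opprB addrA subrK.
have e1 : `|edist_vspace (y - x) V - edist_vspace (z - x) V| <= enorm (y - z).
  have := edist_vspace_lipschitz V (y - x) (z - x).
  have := edist_vspace_lipschitz V (z - x) (y - x).
  rewrite (enormC (z - x)) yz ler_norml; lra.
have e2 : `|alpha * (enorm (y - x) - enorm (z - x))| <= `|alpha| * enorm (y - z).
  by rewrite normrM ler_wpM2l// -yz dist_enorm.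
set A := edist_vspace (y - x) V in e1 *; set B := edist_vspace (z - x) V in e1 *.
have -> : A - alpha * enorm (y - x) - (B - alpha * enorm (z - x)) =
   (A - B) - alpha * (enorm (y - x) - enorm (z - x)) by ring.
by apply: le_trans (ler_normB _ _) _; rewrite mulrDl mul1r; exact: lerD.
Qed.

Lemma open_hcone x theta (alpha : R) : open (hcone x theta alpha).
Proof.
pose h y := alpha * enorm (y - x) - dotv (y - x) theta.
have -> : hcone x theta alpha = [set y | h y < 0].
  by apply/seteqP; split => y; rewrite /hcone /h/= subr_lt0.
apply: (@open_lipschitz_lt0 _ (`|alpha| + enorm theta)) => y z; rewrite /h.
have yz : y - x - (z - x) = y - z by rewrite opprB addrA subrK.
have e1 : `|dotv (y - z) theta| <= enorm theta * enorm (y - z).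
  by rewrite mulrC norm_dotv_le.
have e2 : `|alpha * (enorm (y - x) - enorm (z - x))| <= `|alpha| * enorm (y - z).
  by rewrite normrM ler_wpM2l// -yz dist_enorm.
have -> : alpha * enorm (y - x) - dotv (y - x) theta -
    (alpha * enorm (z - x) - dotv (z - x) theta) =
   alpha * (enorm (y - x) - enorm (z - x)) - dotv (y - z) theta.
  by rewrite -yz (dotvBl (y - x)); ring.
by apply: le_trans (ler_normB _ _) _; rewrite mulrDl; exact: lerD.
Qed.

Lemma measurable_cone x V theta (alpha r : R) :
  measurable ((eball x r `&` xcone x V alpha) `\` hcone x theta alpha
    : set (borel_rV R n)).
Proof.
apply: measurableD; last by apply: measurable_open; exact: open_hcone.
apply: measurableI; first by apply: measurable_closed; exact: closed_eball.
by apply: measurable_open; exact: open_xcone.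
Qed.

End ConeSets.

Section ConeMass.
Context {R : realType} {n kappa : nat}.
Context {f : 'I_kappa -> 'rV[R]_n -> 'rV[R]_n} {rho : 'I_kappa -> R}.
Context (hf : contracting_similarities f rho).
Implicit Types (u v w : seq 'I_kappa) (x y theta : 'rV[R]_n) (V : {vspace 'rV[R]_n}).

(** The linear part of a similarity is orthogonal, so its transpose maps the unit
    normals of [V] and [theta] to unit vectors, and inner products with [y - x] are
    those of the images up to the ratio. *)
Lemma narrow_in_cone (m : nat) (alpha g : R) v x V theta :
  0 < g -> g * m.+1%:R < alpha -> (m <= n)%N -> \dim V = (n - m)%N -> enorm theta = 1 ->
  exists (a : 'I_m -> 'rV[R]_n) theta',
  [/\ forall i, enorm (a i) <= 1, enorm theta' <= 1 &
    forall y, narrow g a theta' (y - x) ->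
    (xcone (comp_word f v x) V alpha `\` hcone (comp_word f v x) theta alpha)
      (comp_word f v y)].
Proof.
move=> g0 ga mn dV t1; have r0 := ratio_gt0 hf v.
have [|a [a1 _ aV]] := @vspace_normals _ _ m V; first by rewrite dV subnK.
have [Q QQ fQ] := comp_word_affine hf v.
have nQ z : enorm (z *m Q^T) = enorm z.
  by rewrite /enorm dotv_mulmx trmxK -mulmxA (mulmx1C QQ) mulmx1.
exists (fun i => a i *m Q^T), (theta *m Q^T); split.
- by move=> i; rewrite nQ a1.
- by rewrite nQ t1.
move=> y [yx ya yt].
pose z := comp_word f v y - comp_word f v x.
have zd b : dotv z b = word_prod rho v * dotv (y - x) (b *m Q^T).
  by rewrite /z fQ dotvZl dotv_mulmx.
have nz : enorm z = word_prod rho v * enorm (y - x) by exact: comp_word_similarity.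
have z0 : 0 < enorm z by rewrite nz mulr_gt0// enorm_gt0.
split; rewrite /xcone /hcone /= -/z.
  apply: (@le_lt_trans _ _ (\sum_(i < m) g * enorm z)).
    apply: le_trans (edist_vspace_le _ (aV z)) _.
    rewrite opprB addrC subrK; apply: le_trans (enorm_sum_le _) _.
    apply: ler_sum => i _; rewrite enormZ a1 mulr1 zd normrM gtr0_norm// nz.
    by rewrite mulrCA ler_pM2l// ya.
  rewrite sumr_const card_ord -mulr_natl mulrA ltr_pM2r//.
  by apply: le_lt_trans ga; rewrite mulrC ler_pM2l// ler_nat.
apply/negP; rewrite -leNgt zd.
apply: (@le_trans _ _ (g * enorm z)).
  by rewrite nz mulrCA ler_pM2l.
rewrite ler_pM2r// (le_trans _ (ltW ga))//.
by rewrite ler_peMr ?(ltW g0)// ler1n.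
Qed.

End ConeMass.

(** * Self-similar measures *)

Section SelfSimilarMeasure.
Context {R : realType} {n kappa : nat} {hkappa : (2 <= kappa)%N}.
Context {f : 'I_kappa -> 'rV[R]_n -> 'rV[R]_n} {rho : 'I_kappa -> R}.
Context (hf : contracting_similarities f rho).
Context {E : set 'rV[R]_n} (hE : self_similar_set f E) (hOSC : open_set_condition f).
Context {p : 'I_kappa -> R} (hp : probability_vector p).
Context {mu : {measure set borel_rV R n -> \bar R}}.
Context {nu : {measure set borel_codespace hkappa -> \bar R}}.
Context {prj : borel_codespace hkappa -> borel_rV R n}.
Context (hnu : is_bernoulli p nu) (hpi : natural_projection f E prj).
Context (hmu : forall A, measurable A -> mu A = pushforward nu prj A).
Implicit Types (u v w : seq 'I_kappa).

Lemma measurable_cylinder w : measurable (cylinder w : set (borel_codespace hkappa)).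
Proof. by apply: sub_gen_smallest; exists w. Qed.

Lemma projection_piece (s : nat -> 'I_kappa) k : piece f E (mkseq s k) (prj s).
Proof.
have : [set prj s] (prj s) by [].
by rewrite hpi => /(_ k I).
Qed.

Lemma cylinder_prefix (s : nat -> 'I_kappa) k : cylinder (mkseq s k) s.
Proof. by rewrite /cylinder /= size_mkseq. Qed.

(** A point of an open set has a whole piece around it in that set, so the
    preimage of an open set is a union of cylinders. *)
Lemma measurable_projection : measurable_fun setT prj.
Proof.
apply: (@measurability _ _ (borel_codespace hkappa) (borel_rV R n) setT prj
  (@open 'rV[R]_n)) => // _ [A oA <-].
rewrite setTI.
have -> : prj @^-1` A = \bigcup_w (if `[< piece f E w `<=` A >] then cylinder w
    else set0 : set (borel_codespace hkappa)).
  apply/seteqP; split => [s /= As|s [w _]]; last first.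
    case: ifPn => // /asboolP wA; rewrite /cylinder/= => sw; apply: wA.
    by rewrite -sw; exact: projection_piece.
  have [c c0 cA] := open_nbhs_eball oA As.
  have [D D0 ED] := attractor_bounded hE.
  have [a [b [_ /andP[b0 b1] _ rb]]] := ratio_bounds hf.
  have [|k bk] := @geometric_small R b D c _ c0; first by rewrite ltW.
  exists (mkseq s k) => //; rewrite ifT; first exact: cylinder_prefix.
  apply/asboolP => x xp; apply: cA; apply: le_trans bk.
  apply: le_trans (piece_diam hf ED xp (projection_piece s k)) _.
  rewrite ler_wpM2r ?(ltW D0)// -[X in _ ^+ X](size_mkseq s).
  by apply: word_prod_le => i; rewrite rb andbT ltW//; have /andP[] := (hf i).1.
apply: countable_bigcupT_measurable => [|w]; first exact: countableP.
by case: ifP => _ //; exact: measurable_cylinder.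
Qed.

Lemma measurable_preimage (A : set (borel_rV R n)) : measurable A ->
  measurable (prj @^-1` A).
Proof. by move=> mA; rewrite -[X in measurable X]setTI; exact: measurable_projection. Qed.

Lemma measure_eq_preimage (A : set (borel_rV R n)) : measurable A ->
  mu A = nu (prj @^-1` A).
Proof. by move=> mA; rewrite hmu. Qed.

Lemma codespace_measure1 : nu setT = 1%E.
Proof.
have := hnu [::]; rewrite big_nil => <-; congr (nu _).
by apply/seteqP; split.
Qed.

Lemma measure_setT1 : mu setT = 1%E.
Proof. by rewrite measure_eq_preimage// preimage_setT codespace_measure1. Qed.

Lemma mass_le_measure w (A : set (borel_rV R n)) : measurable A ->
  piece f E w `<=` A -> ((word_prod p w)%:E <= mu A)%E.
Proof.
move=> mA wA; rewrite measure_eq_preimage// -hnu; apply: le_measure.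
- by rewrite inE; exact: measurable_cylinder.
- by rewrite inE; exact: measurable_preimage.
- move=> s; rewrite /cylinder /= => sw; apply: wA; rewrite -sw.
  exact: projection_piece.
Qed.

Lemma mkseq_take (s : nat -> 'I_kappa) k l : (k <= l)%N -> take k (mkseq s l) = mkseq s k.
Proof.
by move=> kl; rewrite /mkseq -map_take take_iota (minn_idPl kl).
Qed.

(** Borel-Cantelli on the code space, pushed forward.  The image of the set of the
    sequences without bad prefixes beyond [j] is contained in the set of the points
    that have good addresses of every finite length.  The latter is closed, as an
    intersection of finite unions of pieces, because these addresses are not asked
    to extend each other. *)
Lemma ae_good_addresses (bad : pred (seq 'I_kappa)) (C lam : R) : 0 <= lam < 1 ->
  (forall k, \sum_(w : k.-tuple 'I_kappa | bad w) word_prod p w <= C * lam ^+ k) ->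
  {ae mu, forall x : borel_rV R n, exists j, forall K, exists w,
    [/\ size w = K, piece f E w x & forall k, (j <= k <= K)%N -> ~~ bad (take k w)]}.
Proof.
move=> lam01 badC.
pose F k : set (borel_codespace hkappa) :=
  \big[setU/set0]_(w : k.-tuple 'I_kappa | bad w) cylinder w.
have mF k : measurable (F k).
  by apply: bigsetU_measurable => w _; exact: measurable_cylinder.
have F0 : nu (lim_sup_set F) = 0%E.
  apply: (lim_sup_set_geometric mF lam01 (C := C)) => k.
  apply: le_trans (measure_bigsetU_le _ _ _ _) _.
    by move=> w; exact: measurable_cylinder.
  by under eq_bigr do rewrite hnu; rewrite sumEFin lee_fin badC.
pose good j (w : seq 'I_kappa) := forall k, (j <= k <= size w)%N -> ~~ bad (take k w).
pose D j K : set (borel_rV R n) :=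
  \bigcup_(w in [set w : K.-tuple 'I_kappa | good j w]) piece f E w.
have mD j K : measurable (D j K).
  apply: measurable_closed; apply: closed_bigcup; first exact: finite_finset.
  by move=> w _; apply: (closed_piece hf hE).
pose G := \bigcup_j \bigcap_K D j K.
have mG : measurable G.
  by apply: bigcup_measurable => j _; apply: bigcap_measurable.
exists (~` G); split; first exact: measurableC.
  rewrite measure_eq_preimage; last exact: measurableC.
  apply/eqP; rewrite -measure_le0 -F0; apply: le_measure.
  - by rewrite inE; apply: measurable_preimage; exact: measurableC.
  - rewrite inE; apply: bigcap_measurable => // j _.
    by apply: bigcup_measurable => k _.
  move=> s /= sG j _; apply: contrapT => sF; apply: sG.
  exists j => // K _; exists (@Tuple _ _ (mkseq s K) (introT eqP (size_mkseq s K))).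
    move=> /= k /andP[jk]; rewrite size_mkseq => kK; rewrite mkseq_take//.
    apply/negP => bk; apply: sF; exists k => //=; rewrite /F -bigcup_seq_cond.
    exists (@Tuple _ _ (mkseq s k) (introT eqP (size_mkseq s k))) => /=.
      by rewrite mem_index_enum.
    exact: cylinder_prefix.
  exact: projection_piece.
move=> x /= xbad [j _ xj]; apply: xbad; exists j => K.
have [w gw wx] := xj K I; exists w; split; rewrite ?size_tuple//.
by move=> k kK; apply: gw; rewrite size_tuple.
Qed.

Definition charged_points : set (borel_rV R n) :=
  [set prj s | s in [set s : nat -> 'I_kappa | forall k, p (s k) != 0]].

(** Sequences with a letter of probability zero lie in countably many null
    cylinders. *)
Lemma measure_cover_charged (C : set (borel_rV R n)) : measurable C ->
  charged_points `<=` C -> (1 <= mu C)%E.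
Proof.
move=> mC sC; rewrite measure_eq_preimage//.
pose F k : set (borel_codespace hkappa) :=
  \big[setU/set0]_(w : k.-tuple 'I_kappa | word_prod p w == 0) cylinder w.
have mF k : measurable (F k).
  by apply: bigsetU_measurable => w _; exact: measurable_cylinder.
have mUF : measurable (\bigcup_k F k) by apply: bigcupT_measurable.
have F0 : nu (\bigcup_k F k) = 0%E.
  apply/negligibleP => //; apply: negligible_bigcup => k; apply/negligibleP => //.
  apply/eqP; rewrite -measure_le0.
  apply: le_trans (measure_bigsetU_le _ _ _ _) _.
    by move=> w; exact: measurable_cylinder.
  by rewrite big1// => w /eqP w0; rewrite hnu -/(word_prod p w) w0.
have mP := measurable_preimage mC.
rewrite -codespace_measure1 -[leRHS]adde0 -F0.
apply: le_trans (measureU2 _ mP mUF); apply: le_measure; rewrite ?inE//.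
  exact: measurableU.
move=> s _; have [sp|sp] := pselect (forall k, p (s k) != 0); [left|right].
  by apply: sC; exists s.
have [k /negP/negPn/eqP sk] : exists k, ~ (p (s k) != 0) by apply/existsNP.
exists k.+1 => //; rewrite /F -bigcup_seq_cond.
exists (@Tuple _ _ (mkseq s k.+1) (introT eqP (size_mkseq s k.+1))) => /=.
  rewrite mem_index_enum/=; apply/eqP; rewrite /word_prod big_map.
  by rewrite -[k.+1]addn1 iotaD big_cat/= big_seq1 add0n sk mulr0.
exact: cylinder_prefix.
Qed.

Lemma charged_outer_measure : (mu^*)%mu charged_points <> 0%E.
Proof.
move=> mu0.
have : ((mu^*)%mu charged_points < 1%:E)%E by rewrite mu0 lte_fin.
move=> /ereal_inf_lt[_ [A [mA sA] <-]].
apply/negP; rewrite -leNgt.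
apply: le_trans (measure_cover_charged (bigcupT_measurable _ mA) sA) _.
by apply: measure_sigma_subadditive => //; exact: bigcupT_measurable.
Qed.

(** If every charged point failed for one of finitely many cones, the charged points
    would be covered by finitely many Lipschitz graphs.  A point that does not fail
    has, for each cone, a charged point inside; small pieces around these finitely
    many points are as good, for nearby vertices and nearby cones. *)
Lemma nonflat_word (m : nat) (g : R) : purely_unrectifiable m mu -> 0 < g <= 2^-1 ->
  exists2 w0, 0 < word_prod p w0 & exists2 c0, 0 < c0 &
    forall x (a : 'I_m -> 'rV[R]_n) theta, piece f E w0 x ->
    (forall i, enorm (a i) <= 1) -> enorm theta <= 1 ->
    exists2 u, c0 <= word_prod p u &
      forall y, piece f E u y -> narrow (6 * g) a theta (y - x).
Proof.
move=> hun g01; have /andP[g0 _] := g01.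
have [T [vec net]] := @unit_ball_net R n g g0.
pose ja (j : {ffun 'I_m -> T} * T) := fun i => vec (j.1 i).
pose jt (j : {ffun 'I_m -> T} * T) := vec j.2.
have [x0 [s0 s0p <-] x0P] : exists2 x, charged_points x &
    forall j, exists2 y, charged_points y & narrow g (ja j) (jt j) (y - x).
  apply: contrapT => /forall2NP nx; apply: charged_outer_measure; apply: hun.
  pose F j : set 'rV[R]_n := [set x | charged_points x /\
    forall y, charged_points y -> ~ narrow g (ja j) (jt j) (y - x)].
  have /choice[h hP] : forall j, exists h : 'rV[R]_m -> 'rV[R]_n,
      lipschitz_map h /\ F j `<=` range h.
    move=> j; have [|h hL hF] := @not_narrow_graph _ _ _ g (ja j) (jt j) (F j) g0.
      by move=> x y [_ +] [cy _]; apply.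
    by exists h.
  apply: (rectifiable_finite_cover (g := h)) => [j|x cx]; first exact: (hP j).1.
  case: (nx x) => // /existsNP[j jx]; exists j; apply: (hP j).2; split=> // y cy ny.
  by apply: jx; exists y.
have /choice[t tP] : forall j, exists t : nat -> 'I_kappa,
    (forall k, p (t k) != 0) /\ narrow g (ja j) (jt j) (prj t - prj s0).
  by move=> j; have [_ [t tp <-] tn] := x0P j; exists t.
have posp (s : nat -> 'I_kappa) k :
    (forall k, p (s k) != 0) -> 0 < word_prod p (mkseq s k).
  move=> sp; rewrite /word_prod big_map; apply: prodr_gt0 => i _.
  by rewrite lt0r sp hp.1.
have [D D0 ED] := attractor_bounded hE.
have [l [b [_ /andP[b0 b1] _ rb]]] := ratio_bounds hf.
have [j|e e0 ej] := @finite_lower_bound R _ (fun j => g * enorm (prj (t j) - prj s0)).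
  by rewrite mulr_gt0// enorm_gt0//; have [] := (tP j).2.
have e20 : 0 < e / 2 by rewrite divr_gt0.
have [|L bL] := @geometric_small R b D (e / 2) _ e20.
  by rewrite ltW.
have near s x : piece f E (mkseq s L) x -> enorm (x - prj s) <= e / 2.
  move=> xs; apply: le_trans bL.
  apply: le_trans (piece_diam hf ED xs (projection_piece s L)) _.
  rewrite ler_wpM2r ?(ltW D0)//.
  rewrite -[X in _ ^+ X](size_mkseq s L).
  by apply: word_prod_le => i; rewrite rb andbT ltW//; have /andP[] := (hf i).1.
have [j|c0 c00 cj] := @finite_lower_bound R _ (fun j => word_prod p (mkseq (t j) L)).
  by apply: posp; exact: (tP j).1.
exists (mkseq s0 L); first exact: posp.
exists c0 => // x a theta xw a1 t1.
have /choice[ta taP] : forall i, exists t, enorm (a i - vec t) <= g.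
  by move=> i; exact: net.
have [tt ttP] := net _ t1.
pose j : {ffun 'I_m -> T} * T := ([ffun i => ta i], tt).
exists (mkseq (t j) L) => // y yu.
apply: (narrow_perturb g01 a1 t1 _ ttP _ (tP j).2).
  by move=> i; rewrite /ja ffunE.
apply: le_trans (ej j).
have -> : y - x - (prj (t j) - prj s0) = (y - prj (t j)) - (x - prj s0).
  by rewrite !opprB addrACA [RHS]addrACA; congr (_ + _); rewrite addrC.
apply: le_trans (enormD _ _) _; rewrite enormN.
by have := near _ _ xw; have := near _ _ yu; lra.
Qed.

(** Null prefixes have probability zero, heavy balls and late gaps are exponentially
    unlikely: all three are the bad words of [ae_good_addresses].  The constant [C]
    makes the ball of a word contain every ball around a point of its piece whose
    radius is at most the ratio. *)
Lemma ae_regular_addresses w0 Q (t : R) : (0 < Q)%N -> 0 < word_prod p w0 -> 1 < t ->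
  {ae mu, forall x : borel_rV R n, exists j, forall K, exists w,
    [/\ size w = K, piece f E w x & forall k, (j <= k <= K)%N ->
      [/\ word_prod p (take k w) != 0, ~~ late_gap w0 Q (take k w) &
          forall r, r <= word_prod rho (take k w) ->
          (mu (eball x r) <= (t ^+ (2 * k) * word_prod p (take k w))%:E)%E]]}.
Proof.
move=> Q0 w0p t1; have [U [[y0 Uy0] oU fU tU]] := hOSC.
have [c c0 cU] := open_nbhs_eball oU Uy0.
have [D D0 ED] := attractor_bounded hE.
have [[e0 Ee0] _ _] := hE.
pose C := 1 + (D + enorm (e0 - y0)).
have C0 : 0 < C by rewrite addr_gt0// ltr_wpDr.
have [N mult] := word_ball_multiplicity hf fU tU c0 cU C0.
have mB w : measurable (word_ball f rho y0 C w : set (borel_rV R n)).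
  by apply: measurable_closed; exact: (@closed_eball _ _ _ (C * word_prod rho w)).
have [C1 heavy] := sum_heavy_ball_words (p := p) t1 mB measure_setT1 mult.
have [C2 [lam [/andP[lam0 lam1] gap]]] := sum_late_gap hp.1 hp.2 Q0 w0p.
pose isheavy w := ((t ^+ (2 * size w) * word_prod p w)%:E <
  mu (word_ball f rho y0 C w))%E.
pose bad w := [|| word_prod p w == 0, isheavy w | late_gap w0 Q w].
pose s := Num.max t^-1 lam.
have s01 : 0 <= s < 1.
  by rewrite le_max lam0 orbT/= gt_max lam1 invf_lt1 ?t1// (lt_trans ltr01 t1).
have badE k : \sum_(w : k.-tuple 'I_kappa | bad w) word_prod p w <=
    (`|C1| + `|C2|) * s ^+ k.
  have t0 : 0 <= t^-1 by rewrite invr_ge0 (le_trans ler01 (ltW t1)).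
  apply: (@le_trans _ _ (C1 * t^-1 ^+ k + C2 * lam ^+ k)).
    apply: le_trans (lerD (heavy k) (gap k)).
    rewrite [leLHS]big_mkcond [X in _ <= X + _]big_mkcond [X in _ <= _ + X]big_mkcond.
    rewrite -big_split/=; apply: ler_sum => w _; rewrite /bad -/(isheavy w).
    have w0' : 0 <= word_prod p w by apply: word_prod_ge0; exact: hp.1.
    case: (eqVneq (word_prod p w) 0) => [->|_] /=.
      by rewrite !if_same addr0.
    case: (isheavy w); case: (late_gap w0 Q w); rewrite /= ?addr0 ?add0r//.
    by rewrite lerDl.
  rewrite mulrDl; apply: lerD.
    apply: (@le_trans _ _ (`|C1| * t^-1 ^+ k)).
      by rewrite ler_wpM2r ?exprn_ge0// ler_norm.
    by rewrite ler_wpM2l// lerXn2r ?nnegrE ?le_max ?lexx// t0.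
  apply: (@le_trans _ _ (`|C2| * lam ^+ k)).
    by rewrite ler_wpM2r ?exprn_ge0// ler_norm.
  by rewrite ler_wpM2l// lerXn2r ?nnegrE ?le_max ?lexx ?lam0 ?orbT.
have := ae_good_addresses s01 badE.
apply: filterS => x [j xj]; exists j => K.
have [w [wK xw wgood]] := xj K; exists w; split => // k jkK.
have := wgood _ jkK; rewrite /bad !negb_or => /and3P[pk hk gk]; split => // r rk.
have szk : size (take k w) = k by rewrite size_takel// wK; have /andP[] := jkK.
move: hk; rewrite /isheavy -leNgt szk; apply: le_trans.
apply: le_measure; rewrite ?inE//.
  by apply: measurable_closed; exact: closed_eball.
have xk : piece f E (take k w) x.
  by rewrite -(cat_take_drop k w) in xw; exact: (piece_cat hE xw).
case: xk => x' Ex' x'x y; rewrite /eball /word_ball /eball /= => yx.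
apply: le_trans (enorm_triangle x _ _) _.
have r0 := ratio_gt0 hf (take k w).
rewrite /C mulrDl mul1r; apply: lerD; first exact: le_trans yx rk.
rewrite -x'x (comp_word_similarity hf) mulrC ler_wpM2r ?(ltW r0)//.
by apply: le_trans (enorm_triangle e0 _ _) _; rewrite lerD2r ED.
Qed.

Definition cone (alpha : R) (x : 'rV[R]_n) (r : R) (V : {vspace 'rV[R]_n})
    (theta : 'rV[R]_n) : set (borel_rV R n) :=
  (eball x r `&` xcone x V alpha) `\` hcone x theta alpha.

(** The similarity of [v] transports the pieces of [nonflat_word] to the cones at the
    points of [E] whose address continues with [w0] after [v]. *)
Lemma cone_mass_at_occurrence (m : nat) (alpha : R) : (m <= n)%N -> 0 < alpha ->
  purely_unrectifiable m mu ->
  exists2 w0, 0 < word_prod p w0 & exists2 c0, 0 < c0 &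
    exists2 D, 0 < D &
    forall v x r V theta, piece f E (v ++ w0) x -> word_prod rho v * D <= r ->
    grassmannian (n - m) V -> esphere theta ->
    ((c0 * word_prod p v)%:E <= mu (cone alpha x r V theta))%E.
Proof.
move=> mn alpha0 hun.
(* The opening [6 * g] bounds each of the [m] normal components, so the distance to
   the plane is governed by [6 * g * m]. *)
pose g := Num.min (2^-1) (alpha / (12 * m.+1%:R)).
have g0 : 0 < g by rewrite lt_min invr_gt0 ltr0Sn divr_gt0// mulr_gt0.
have g01 : 0 < g <= 2^-1 by rewrite g0 ge_min lexx.
have g6 : 0 < 6 * g by rewrite mulr_gt0.
have ga : 6 * g * m.+1%:R < alpha.
  have : g <= alpha / (12 * m.+1%:R) by rewrite ge_min lexx orbT.
  rewrite ler_pdivlMr ?mulr_gt0// => h; lra.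
have [w0 w0p [c0 c00 w0P]] := nonflat_word hun g01.
have [D D0 ED] := attractor_bounded hE.
exists w0 => //; exists c0 => //; exists D => // v z r V theta.
move=> /piece_cat_preimage[x xw0 ->{z}] vr dV t1.
have [a [theta' [a1 t1' cP]]] := narrow_in_cone hf v x g6 ga mn dV t1.
have [u uc uP] := w0P x a theta' xw0 a1 t1'.
apply: (@le_trans _ _ (word_prod p (v ++ u))%:E).
  rewrite lee_fin word_prod_cat mulrC ler_wpM2l//.
  by apply: word_prod_ge0; exact: hp.1.
apply: mass_le_measure; first exact: measurable_cone.
move=> _ /piece_cat_preimage[y yu ->].
have [yx yt] := cP _ (uP _ yu); split => //; split => //.
apply: le_trans vr; rewrite /= (comp_word_similarity hf).
rewrite ler_wpM2l ?(ltW (ratio_gt0 hf v))//.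
by apply: ED; [exact: (piece_sub hE yu)|exact: (piece_sub hE xw0)].
Qed.

(** Along a regular address let [v] be the last prefix with ratio at least [r], and
    [v ++ s] the prefix before the next occurrence of [w0].  The ball has mass at most
    [t ^+ (2 * k) * word_prod p v], the cone at least
    [c0 * word_prod p v * word_prod p s]. *)
Lemma cone_mass_ae (m : nat) (alpha delta : R) : (m <= n)%N -> 0 < alpha ->
  purely_unrectifiable m mu -> 0 < delta ->
  {ae mu, forall x : borel_rV R n, exists c r0, [/\ 0 < c, 0 < r0 &
    forall r V theta, 0 < r < r0 -> grassmannian (n - m) V -> esphere theta ->
    ((c * r `^ delta)%:E * mu (eball x r) <= mu (cone alpha x r V theta))%E]}.
Proof.
move=> mn alpha0 hun d0.
have [w0 w0p [c0 c00 [D D0 coneP]]] := cone_mass_at_occurrence mn alpha0 hun.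
have [a [b [a0 b01 ra rb]]] := ratio_bounds hf.
have /andP[b0 b1] := b01.
have [|L1 bL1] := @geometric_small R b D 1 _ ltr01; first by rewrite (ltW b0).
have [pm pm01 pmP] := positive_lower_bound hp.
(* The first [l] letters after the length [k] are spent on shrinking the piece to a
   diameter of at most [r]: one letter brings the ratio below [r], and [L1] more
   compensate for the diameter of [E]. *)
pose l := L1.+1; pose L := size w0.
have [t [Q [c [t1 Q0 c1 expP]]]] := exponent_choice l L b01 pm01 d0.
have rho0 i : 0 <= rho i <= b by rewrite rb andbT ltW//; have /andP[] := (hf i).1.
have := ae_regular_addresses Q0 w0p t1.
apply: filterS => x [j xj]; exists (c0 * c), (Num.min (a ^+ j) 1).
split; rewrite ?mulr_gt0 ?lt_min ?exprn_gt0 ?ltr01//.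
move=> r V theta /andP[r0]; rewrite lt_min => /andP[raj r1] dV th1.
have r20 : 0 < r / 2 by rewrite divr_gt0.
have [|K0 bK0] := @geometric_small R b 1 (r / 2) _ r20; first by rewrite (ltW b0).
(* Addresses of different lengths are unrelated, so the whole argument has to fit
   into one address: its length [K] bounds all positions used below. *)
pose K := (K0 + l + (K0 + l) * L)%N.
have K0K : (K0 <= K)%N by rewrite /K -addnA leq_addr.
have [w [wK xw wgood]] := xj K.
have [|||k kK0 [rk rk1]] := @comparable_length _ _ rho b r w K0 _ _ _ rho0.
- by rewrite r0 ltW.
- rewrite mulr1 in bK0; apply: le_lt_trans bK0 _.
  by rewrite ltr_pdivrMr// ltr_pMr// ltr1n.
- by rewrite wK.
have jk : (j <= k)%N.
  rewrite leqNgt; apply/negP => kj; move: (lt_trans rk1 raj); apply/negP; rewrite -leNgt.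
  apply: (@le_trans _ _ (a ^+ k.+1)).
    rewrite ler_wiXn2l ?(ltW a0)//.
    have i0 : 'I_kappa := Ordinal (ltnW hkappa).
    by rewrite (le_trans (ra i0))// (le_trans (rb i0))// ltW.
  have := @word_prod_ge _ _ rho (take k.+1 w) a (ltW a0) (fun i _ => ra i).
  by rewrite size_takel// wK (leq_trans kK0).
pose q := ((k + l) %/ Q)%N.
have qkl : (q <= k + l)%N by exact: leq_div.
have kK : (k + l + q * L <= size w)%N.
  have : (q * L <= (K0 + l) * L)%N.
    by rewrite leq_mul2r (leq_trans qkl) ?orbT// leq_add2r ltnW.
  by rewrite wK /K => h; apply: leq_add => //; rewrite leq_add2r ltnW.
have gap i : (j <= i <= size w)%N -> ~~ late_gap w0 Q (take i w).
  by rewrite wK => /wgood[].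
have [s [s' [wE /andP[sl sq]]]] := next_occurrence Q0 jk kK gap.
set v := take k w in wE rk; have kK' : (k <= K)%N by rewrite (leq_trans (ltnW kK0)).
have vk : size v = k by rewrite size_takel// wK.
have [v0 _ ballv] : [/\ word_prod p v != 0, ~~ late_gap w0 Q v &
    forall r, r <= word_prod rho v ->
    (mu (eball x r) <= (t ^+ (2 * k) * word_prod p v)%:E)%E].
  by apply: wgood; rewrite jk.
have w0' : word_prod p w != 0.
  have [] := wgood K _; first by rewrite leqnn andbT (leq_trans jk).
  by rewrite -wK take_size.
have pv : 0 <= word_prod p v by apply: word_prod_ge0; exact: hp.1.
have ps : pm ^+ (l + q * L) <= word_prod p s.
  have /andP[pm0 pm1] := pm01.
  apply: (@le_trans _ _ (pm ^+ size s)); first by rewrite ler_wiXn2l// ltW.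
  apply: word_prod_ge; first exact: ltW.
  move=> i si; apply: pmP; apply: (word_prod_neq0 w0').
  by rewrite wE !mem_cat si orbT.
have xv : piece f E ((v ++ s) ++ w0) x.
  by move: xw; rewrite wE !catA; exact: piece_cat.
have vsr : word_prod rho (v ++ s) * D <= r.
  case: s wE sl {sq ps xv} => [//|i s] wE; rewrite /= ltnS => sl.
  rewrite -cat_rcons word_prod_cat.
  have -> : rcons v i = take k.+1 w.
    by rewrite wE -cat_rcons take_size_cat// size_rcons vk.
  rewrite -mulrA -[leRHS]mulr1; apply: ler_pM; rewrite ?(ltW rk1)//.
  - exact: ltW (ratio_gt0 hf _).
  - by rewrite mulr_ge0 ?(ltW D0)// ltW ?(ratio_gt0 hf).
  apply: le_trans bL1; rewrite ler_wpM2r ?(ltW D0)//.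
  apply: (@le_trans _ _ (b ^+ size s)); first exact: word_prod_le.
  by rewrite ler_wiXn2l ?(ltW b0) ?(ltW b1).
apply: le_trans (coneP _ _ _ _ _ xv vsr dV th1).
have rkb : 0 < r <= b ^+ k.
  by rewrite r0 (le_trans rk)// -vk; exact: word_prod_le.
have cr0 : 0 <= c0 * c * r `^ delta by rewrite !mulr_ge0 ?powR_ge0// ltW.
apply: (@le_trans _ _ ((c0 * c * r `^ delta)%:E * (t ^+ (2 * k) * word_prod p v)%:E)%E).
  by apply: lee_wpmul2l; [rewrite lee_fin|exact: ballv].
rewrite -EFinM lee_fin word_prod_cat mulrA [leRHS]mulrA [leRHS]mulrAC ler_wpM2r//.
rewrite -!mulrA ler_pM2l// mulrA; exact: le_trans (expP _ _ rkb) ps.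
Qed.

End SelfSimilarMeasure.

(** * Local dimensions *)

Section LimsupPerturbation.
Context {R : realType} (F : set_system R) {FF : Filter F}.
Implicit Types f g : R -> \bar R.

Lemma limf_esup_le_add f g (e : R) :
  F [set r | (f r <= g r + e%:E)%E] ->
  (limf_esup f F <= limf_esup g F + e%:E)%E.
Proof.
move=> fg; rewrite -leeBlDr//; apply: le_ereal_inf_tmp => _ [W FW <-].
rewrite leeBlDr//.
apply: (@le_trans _ _ (ereal_sup (f @` (W `&` [set r | (f r <= g r + e%:E)%E])))).
  apply: ereal_inf_lbound.
  by exists (W `&` [set r | (f r <= g r + e%:E)%E]) => //; exact: filterI.
apply: ge_ereal_sup => _ [r [Wr fgr] <-]; apply: le_trans fgr _; rewrite leeD2r//.
by apply: ereal_sup_ubound; exists r.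
Qed.

Lemma limf_einf_le_add f g (e : R) :
  F [set r | (f r <= g r + e%:E)%E] ->
  (limf_einf f F <= limf_einf g F + e%:E)%E.
Proof.
move=> fg; rewrite /limf_einf -leeBlDr// -fin_num_oppeD// leeN2.
apply: limf_esup_le_add; apply: filterS fg => r /= fgr.
by rewrite -leeBlDr// -fin_num_oppeD// leeN2.
Qed.

Lemma limf_eq_of_close f g : F [set r | (f r <= g r)%E] ->
  (forall e, 0 < e -> F [set r | (g r <= f r + e%:E)%E]) ->
  limf_esup f F = limf_esup g F /\ limf_einf f F = limf_einf g F.
Proof.
move=> fg gf; have fg0 : F [set r | (f r <= g r + 0%:E)%E].
  by apply: filterS fg => r /=; rewrite adde0.
split; apply/eqP; rewrite eq_le; apply/andP; split.
- by rewrite -[leRHS]adde0; exact: limf_esup_le_add.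
- by apply/lee_addgt0Pr => e e0; apply: limf_esup_le_add; exact: gf.
- by rewrite -[leRHS]adde0; exact: limf_einf_le_add.
- by apply/lee_addgt0Pr => e e0; apply: limf_einf_le_add; exact: gf.
Qed.

End LimsupPerturbation.

Section LogRatio.
Context {R : realType} {n : nat} {mu : {measure set borel_rV R n -> \bar R}}.
Context (mu1 : mu setT = 1%E).
Implicit Types (A B : set (borel_rV R n)) (r e : R).

Lemma fin_num_probability A : measurable A -> mu A \is a fin_num.
Proof.
move=> mA; rewrite ge0_fin_numE// (le_lt_trans _ (ltry 1))// -mu1.
by apply: le_measure; rewrite ?inE.
Qed.

Lemma log_ratioE A r : 0 < r < 1 -> measurable A ->
  log_ratio mu A r = if mu A == 0%E then +oo%E else (ln (fine (mu A)) / ln r)%:E.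
Proof.
move=> r01 mA; have lnr : ln r < 0 by exact: ln_lt0.
rewrite /log_ratio inver lt_eqF//.
case: ifPn => [/eqP ->|A0].
  by rewrite le0_lneNy// muleC lt0_muleNy// lte_fin invr_lt0.
have Afin := fin_num_probability mA.
rewrite -{1}(fineK Afin) lne_EFin// fine_gt0// ltey_eq Afin andbT.
by rewrite lt0e A0 measure_ge0.
Qed.

Lemma log_ratio_anti A B r : 0 < r < 1 -> measurable A -> measurable B ->
  A `<=` B -> (log_ratio mu B r <= log_ratio mu A r)%E.
Proof.
move=> r01 mA mB AB; rewrite !log_ratioE//.
have muAB : (mu A <= mu B)%E by apply: le_measure; rewrite ?inE.
case: (eqVneq (mu A) 0%E) => [_|A0]; first by rewrite leey.
have A0' : (0 < mu A)%E by rewrite lt0e A0 measure_ge0.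
have B0' : (0 < mu B)%E by exact: lt_le_trans muAB.
have fin := fin_num_probability.
rewrite gt_eqF// lee_fin; apply: ler_wnM2r; first by rewrite invr_le0 ltW// ln_lt0.
by rewrite ler_ln ?posrE ?fine_gt0 ?ltey_eq ?fin ?A0' ?B0'// fine_le ?fin.
Qed.

Lemma log_ratio_le_add A B r e : 0 < r < 1 -> measurable A -> measurable B ->
  ((r `^ e)%:E * mu B <= mu A)%E -> (log_ratio mu A r <= log_ratio mu B r + e%:E)%E.
Proof.
move=> r01 mA mB AB; rewrite !log_ratioE//; have lnr : ln r < 0 by exact: ln_lt0.
have /andP[r0 r1] := r01.
have fin := fin_num_probability.
case: (eqVneq (mu B) 0%E) => [_|B0]; first by rewrite addye// leey.
move: AB; rewrite -(fineK (fin _ mA)) -(fineK (fin _ mB)) -EFinM lee_fin => AB.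
have B0' : 0 < fine (mu B).
  by rewrite fine_gt0// ltey_eq (fin _ mB) andbT lt0e B0 measure_ge0.
have rB : 0 < r `^ e * fine (mu B) by rewrite mulr_gt0 ?powR_gt0.
have A0' : 0 < fine (mu A) by exact: lt_le_trans AB.
rewrite eqe gt_eqF// -EFinD lee_fin ler_ndivrMr// mulrDl divfK ?lt_eqF//.
have := AB; rewrite -ler_ln ?posrE// lnM ?posrE ?powR_gt0// ln_powR.
by rewrite addrC.
Qed.

End LogRatio.

Lemma grassmannian_neq0 {R : realType} {n d : nat} : (d <= n)%N ->
  @grassmannian R n d !=set0.
Proof.
move=> dn; have := vbasisP (fullv : {vspace 'rV[R]_n}).
set X := vbasis _ => /basis_free fX.
have sX : size X = n by rewrite size_tuple dimvf /dim/= mul1n.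
exists <<take d X>>%VS; rewrite /grassmannian /=.
have /eqP -> : free (take d X).
  by apply: (@catl_free _ _ (drop d X) (take d X)); rewrite cat_take_drop.
by rewrite size_takel// sX.
Qed.

Theorem corollary4p2 (R : realType) (n m : nat) (hm : (m < n)%N)
    (kappa : nat) (hkappa : (2 <= kappa)%N)
    (f : 'I_kappa -> 'rV[R]_n -> 'rV[R]_n) (rho : 'I_kappa -> R)
    (hf : contracting_similarities f rho)
    (E : set 'rV[R]_n) (hE : self_similar_set f E)
    (hOSC : open_set_condition f)
    (p : 'I_kappa -> R) (hp : probability_vector p)
    (mu : {measure set borel_rV R n -> \bar R})
    (hmu : self_similar_measure hkappa f E p mu)
    (hmu_unrect : purely_unrectifiable m mu)
    (alpha : R) (halpha : 0 < alpha <= 1) :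
  {ae mu, forall x : borel_rV R n,
    upper_local_dim mu x = limf_esup (sup_cone_log_ratio mu m alpha x) 0^'+ /\
    lower_local_dim mu x = limf_einf (sup_cone_log_ratio mu m alpha x) 0^'+}.
Proof.
have [nu [prj [hnu hprj hpush]]] := hmu.
have mu1 := measure_setT1 hnu hpush.
have /andP[alpha0 _] := halpha.
have mball x r : measurable (eball x r : set (borel_rV R n)).
  by apply: measurable_closed; exact: closed_eball.
have [|theta0 theta01 _] := @unit_normal R n 0%VS.
  by rewrite dimv0; exact: leq_ltn_trans hm.
have : {ae mu, forall x : borel_rV R n, forall N, exists c r0, [/\ 0 < c, 0 < r0 &
    forall r V theta, 0 < r < r0 -> grassmannian (n - m) V -> esphere theta ->
    ((c * r `^ (N.+1%:R^-1))%:E * mu (eball x r) <= mu (cone alpha x r V theta))%E]}.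
  apply/ae_foralln => N.
  apply: (cone_mass_ae hf hE hOSC hp hnu hprj hpush (ltnW hm) alpha0 hmu_unrect).
  by rewrite invr_gt0.
apply: filterS => x xP; apply: limf_eq_of_close.
  near=> r; have r01 : 0 < r < 1.
    by apply/andP; split; near: r; [exact: nbhs_right_gt|exact: nbhs_right_lt].
  have [V0 dV0] := @grassmannian_neq0 R n (n - m) (leq_subr _ _).
  apply: (@le_trans _ _ (log_ratio mu (cone alpha x r V0 theta0) r)).
    apply: log_ratio_anti => //; first exact: measurable_cone.
    by move=> y [[]].
  by apply: ereal_sup_ubound; exists theta0 => //; exists V0.
move=> e e0; have e20 : 0 < e / 2 by rewrite divr_gt0.
have [N Ne] : exists N : nat, N.+1%:R^-1 <= e / 2.
  exists (Num.truncn (2 / e)); rewrite -[leRHS]invrK lef_pV2 ?posrE ?invr_gt0 ?divr_gt0//.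
  by rewrite invf_div ltW// truncnS_gt.
have [c [r0 [c0 r00 cP]]] := xP N.
near=> r; have r_gt0 : 0 < r by near: r; exact: nbhs_right_gt.
have r01 : 0 < r < 1 by rewrite r_gt0; near: r; exact: nbhs_right_lt.
have rr0 : 0 < r < r0 by rewrite r_gt0; near: r; exact: nbhs_right_lt.
(* Half of [e] is used to absorb the constant [c]. *)
have rc : r <= c `^ (2 / e).
  by rewrite ltW//; near: r; apply: nbhs_right_lt; exact: powR_gt0.
apply: ge_ereal_sup => _ [theta th [V dV <-]].
apply: log_ratio_le_add => //; first exact: measurable_cone.
apply: le_trans (cP r V theta rr0 dV th).
apply: lee_wpmul2r => //; rewrite lee_fin.
have re : r `^ (e / 2) <= c.
  have := ge0_ler_powR (ltW e20) (ltW r_gt0 : r \in Num.nneg)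
    (powR_ge0 _ _ : _ \in Num.nneg) rc.
  by rewrite -powRrM mulrA divfK ?divff ?gt_eqF// powRr1 // ltW.
rewrite [e]splitr powRD; last by apply/implyP => _; rewrite gt_eqF.
apply: ler_pM; rewrite ?powR_ge0//.
by apply: ger_powR => //; have /andP[-> /ltW] := r01.
Unshelve. all: by end_near. Qed.
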